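(* Fix integers $m\ge d\ge1$, $\lambda=d/m$, and a monic polynomial $p$ of degree $d$ with real nonnegative roots, $\mu=\mu_{\mathbb{S}p}$. Then, as power series in $s$ at $0$, \[ \widetilde{\mathcal R}^{d,\lambda}_\mu(s)\equiv\mathcal R^{d,\lambda}_{\mathbb{S}p}(s^2)\pmod{s^{d+1}}, \] i.e. the coefficients of $s^0,\dots,s^d$ of the two sides agree.
   Context: Let $R$ be the largest root of $p$, $\mathbb{S}p(x)=p(x^2)$. $\mathcal G(x)=\frac1d\frac{xp'(x^2)}{p(x^2)}$, $\mathcal H(x)=\mathcal G(x)(\lambda\mathcal G(x)+(1-\lambda)/x)$, a decreasing bijection $(\sqrt R,\infty)\to(0,\infty)$ with inverse $\mathcal J$. For $s>0$: $z=\mathcal J(s^2)$, $r(s)=\frac1{\sqrt{md}}\frac{zp'(z^2)}{p(z^2)}$, $t(s)=r(s)+\frac{m-d}{\sqrt{md}z}$; $r,t$ extend analytically to a neighborhood of $0$ with $r(s)=s+O(s^2)$, $t(s)=s+O(s^2)$. $X=[\sqrt R,\infty)^2$, $\Delta(x,y)=y^{(m-d)/\sqrt{md}}p(xy)^{1/\sqrt{md}}$, $\|f\|_q=(\iint_Xf^q\,dx\,dy)^{1/q}$, $\mathcal Q^{d,\lambda}_\mu(s)=\big[\partial_r\log\|e^{-xr-yt}\Delta\|_{\sqrt{md}}\cdot\partial_t\log\|e^{-xr-yt}\Delta\|_{\sqrt{md}}\big]_{r=r(s),t=t(s)}$, and $\widetilde{\mathcal R}^{d,\lambda}_\mu(s)=\sqrt{\frac1\lambda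 s^2\mathcal Q^{d,\lambda}_\mu(s)+\frac{(1-\lambda)^2}{4\lambda^2}}-\big(\frac{\lambda+1}{2\lambda}+\frac1d\big)$, which extends analytically to a neighborhood of $s=0$ (so it has a power series expansion there). Finite $R$-transform: writing $p=\sum_{i=0}^d(-1)^ip_ix^{d-i}$ and $E_p(s)=\sum_{i=0}^d(-1)^i(md)^i\frac{(m-i)!(d-i)!}{m!d!}p_is^i$, $\mathcal R^{d,\lambda}_{\mathbb{S}p}(s)$ is the polynomial of degree $\le d$ agreeing with $-\frac sd\frac d{ds}\log E_p(s)$ mod $s^{d+1}$. *)

(* Defs.v *)
From HB Require Import structures.
From mathcomp Require Import all_boot all_order all_algebra.
From mathcomp Require Import all_classical all_reals all_analysis.
Set Implicit Arguments. Unset Strict Implicit. Unset Printing Implicit Defensive.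
Import Order.TTheory GRing.Theory Num.Theory.
Import numFieldNormedType.Exports.
Local Open Scope classical_set_scope.
Local Open Scope ring_scope.

Section Defs.
Variables (R : realType) (m d : nat) (p : {poly R}).

Definition lam : R := d%:R / m%:R.

Definition largest_root : R := sup [set x : R | root p x].

Definition Gf (x : R) : R := d%:R^-1 * (x * p^`().[x ^+ 2] / p.[x ^+ 2]).

Definition Hf (x : R) : R := Gf x * (lam * Gf x + (1 - lam) / x).

(* J = inverse of the bijection H : (sqrt R, oo) -> (0, oo) *)
Definition Jf (u : R) : R :=
  xget 0 [set z : R | Num.sqrt largest_root < z /\ Hf z = u].

Definition smd : R := Num.sqrt (m%:R * d%:R).

Definition zf (s : R) : R := Jf (s ^+ 2).

Definition rf (s : R) : R :=
  let z := zf s in smd^-1 * (z * p^`().[z ^+ 2] / p.[z ^+ 2]).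

Definition tf (s : R) : R :=
  rf s + (m%:R - d%:R) / (smd * zf s).

Definition Xdom : set (R * R) :=
  [set xy | Num.sqrt largest_root <= xy.1 /\ Num.sqrt largest_root <= xy.2].

Definition Delta (xy : R * R) : R :=
  (xy.2 `^ ((m%:R - d%:R) / smd)) * (p.[xy.1 * xy.2] `^ smd^-1).

Definition normq (r t : R) : R :=
  (fine (\int[product_measure1 (@lebesgue_measure R) (@lebesgue_measure R)]_(xy in Xdom)
     ((expR (- xy.1 * r - xy.2 * t) * Delta xy) `^ smd)%:E)) `^ smd^-1.

Definition Qf (s : R) : R :=
  derive1 (fun r => ln (normq r (tf s))) (rf s) *
  derive1 (fun t => ln (normq (rf s) t)) (tf s).

Definition Rtilde (s : R) : R :=
  Num.sqrt (lam^-1 * s ^+ 2 * Qf s + (1 - lam) ^+ 2 / (4 * lam ^+ 2))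
  - ((lam + 1) / (2 * lam) + d%:R^-1).

(* p = sum_i (-1)^i p_i x^(d-i) *)
Definition pcoef (i : nat) : R := (-1) ^+ i * p`_(d - i).

Definition Ep : {poly R} :=
  \poly_(i < d.+1)
    ((-1) ^+ i * (m%:R * d%:R) ^+ i * (((m - i)`! * (d - i)`!)%:R
      / ((m`! * d`!)%:R)) * pcoef i).

(* Rp is the finite R-transform: deg Rp <= d and
   Rp = -(s/d) E_p'/E_p  mod s^(d+1)  (as formal power series; since
   E_p(0) = 1 is a unit, this is equivalent to d Rp E_p + s E_p' = 0
   mod s^(d+1)). *)
Definition is_finite_R_transform (Rp : {poly R}) : Prop :=
  (size Rp <= d.+1)%N /\
  forall k, (k <= d)%N -> (d%:R *: (Rp * Ep) + 'X * Ep^`())`_k = 0.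

End Defs.

(* Main.v *)
Require Import Defs.
From HB Require Import structures.
From mathcomp Require Import all_boot all_order all_algebra.
From mathcomp Require Import all_classical all_reals all_analysis.
From mathcomp Require Import measurable_realfun.
From mathcomp Require Import ring lra zify.
Import Order.TTheory GRing.Theory Num.Theory.
Import numFieldNormedType.Exports.
Local Open Scope classical_set_scope.
Local Open Scope ring_scope.

Set Implicit Arguments.
Unset Strict Implicit.
Unset Printing Implicit Defensive.

(* Write N = sqrt(md), a = sqrt(largest root of p), c = N r(s), c' = N t(s).
   The equation H(z) = s^2 says exactly that r(s) t(s) = s^2. Expanding p, the
   N-th power of the norm is the sum over j of
   p_j M_j(c) M_{m-d+j}(c'), where p_j is the coefficient of x^j in p and
   M_k(c) is the integral of x^k exp(-cx) over [a, +oo), and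
   d/dc M_k = - M_{k+1}. Since
   c^{k+1} M_k(c) = k! + O(c^{k+1}), the quantity - r d/dr log of the
   integral is d + 1 - u E'(u)/E(u) at u = s^2, up to O(s^{d+1}), that is
   d + 1 + d R(s^2) with R the finite R-transform; likewise in t with m + 1.
   The constants in the definition of R-tilde complete the square.
   For the expansion itself, exp(ca) c^{k+1} M_k(c) is a polynomial in c, so
   R-tilde is obtained from r and t by field operations and a square root, and
   w = 1/z is s sqrt(y) with y an analytic solution of a polynomial equation. *)

(** * Power series at 0 *)

(** The formulas for r and t depend on s only through s^2, while their analytic extensions start
    with s; and H is positive on its domain, so [Jf] has only a default value at 0. Hence every
    statement about [rf], [tf] and [Rtilde] concerns small s > 0, which is enough because the values
    on one side of 0 determine all coefficients. Existence of the expansion and the value of its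
    coefficients are proved separately, because they treat the exponentials in opposite ways. For
    analyticity the factor exp(-a(c + c')) is cancelled from quotients of moments, leaving
    polynomials in c and c'. For the comparison of coefficients it has to stay: k! + O(y^(k+1))
    describes exp(-y) [(incexp k).[y]], not [(incexp k).[y]] alone. *)

Section PolyNorm.
Variable R : realType.
Implicit Types (P Q : {poly R}) (rho : R).

Definition abs_poly P : {poly R} := \poly_(i < size P) `|P`_i|.

(** The l1 norm with weights rho^i. It is submultiplicative, compatible with composition, and bounds
    |P| on [0, rho]; each of these reduces to a coefficientwise comparison of majorants. *)
Definition pnorm rho P : R := (abs_poly P).[rho].

Lemma coef_abs_poly P i : (abs_poly P)`_i = `|P`_i|.
Proof.
rewrite coef_poly; case: ltnP => // h.
by rewrite nth_default // normr0.
Qed.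

Lemma le_horner rho P Q : 0 <= rho -> (forall i, P`_i <= Q`_i) ->
  P.[rho] <= Q.[rho].
Proof.
move=> rho0 PQ; rewrite -subr_ge0 -hornerN -hornerD horner_coef.
apply: sumr_ge0 => i _; apply: mulr_ge0; last exact: exprn_ge0.
by rewrite coefB subr_ge0.
Qed.

Lemma pnorm_ge0 rho P : 0 <= rho -> 0 <= pnorm rho P.
Proof.
move=> rho0; rewrite -(horner0 rho); apply: le_horner => // i.
by rewrite coef0 coef_abs_poly.
Qed.

Lemma pnorm_le P s rho : 0 <= s -> s <= rho -> pnorm s P <= pnorm rho P.
Proof.
move=> s0 sr; rewrite /pnorm !horner_coef; apply: ler_sum => i _.
rewrite coef_abs_poly; apply: ler_wpM2l => //.
by apply: lerXn2r; rewrite ?nnegrE //; apply: le_trans sr.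
Qed.

Lemma horner_le_pnorm P s : 0 <= s -> `|P.[s]| <= pnorm s P.
Proof.
move=> s0; rewrite ler_norml /pnorm -hornerN; apply/andP; split.
  by apply: le_horner => // i; rewrite coefN coef_abs_poly lerNl ler_normr lexx orbT.
by apply: le_horner => // i; rewrite coef_abs_poly ler_norm.
Qed.

Lemma pnormD rho P Q : 0 <= rho -> pnorm rho (P + Q) <= pnorm rho P + pnorm rho Q.
Proof.
move=> rho0; rewrite /pnorm -hornerD; apply: le_horner => // i.
by rewrite coefD !coef_abs_poly coefD ler_normD.
Qed.

Lemma pnormN rho P : pnorm rho (- P) = pnorm rho P.
Proof.
by congr (horner _ _); apply/polyP => i; rewrite !coef_abs_poly coefN normrN.
Qed.

Lemma pnormB rho P Q : 0 <= rho -> pnorm rho (P - Q) <= pnorm rho P + pnorm rho Q.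
Proof. by move=> h; rewrite -(pnormN _ Q) pnormD. Qed.

Lemma pnormM rho P Q : 0 <= rho -> pnorm rho (P * Q) <= pnorm rho P * pnorm rho Q.
Proof.
move=> rho0; rewrite /pnorm -hornerM; apply: le_horner => // i.
rewrite coef_abs_poly !coefM; apply: le_trans (ler_norm_sum _ _ _) _.
by apply: ler_sum => j _; rewrite !coef_abs_poly normrM.
Qed.

Lemma pnormC rho c : pnorm rho c%:P = `|c|.
Proof.
have -> : pnorm rho c%:P = (`|c|%:P).[rho]; last by rewrite hornerC.
congr (horner _ _); apply/polyP => i; rewrite coef_abs_poly !coefC.
by case: eqP => // _; rewrite normr0.
Qed.

Lemma pnorm1 rho : pnorm rho 1 = 1.
Proof. by rewrite -polyC1 pnormC normr1. Qed.

Lemma pnormX rho : pnorm rho 'X = rho.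
Proof.
rewrite -[RHS]hornerX; congr (horner _ _).
by apply/polyP => i; rewrite coef_abs_poly coefX normr_nat.
Qed.

Lemma pnormXn rho P n : 0 <= rho -> pnorm rho (P ^+ n) <= pnorm rho P ^+ n.
Proof.
move=> r0; elim: n => [|n IH]; first by rewrite !expr0 pnorm1.
rewrite !exprS; apply: le_trans (pnormM _ _ r0) _.
by apply: ler_wpM2l => //; exact: pnorm_ge0.
Qed.

Lemma pnormZ rho c P : 0 <= rho -> pnorm rho (c *: P) <= `|c| * pnorm rho P.
Proof. by move=> r0; rewrite -mul_polyC -(pnormC rho); exact: pnormM. Qed.

Lemma pnorm_sum rho n (F : nat -> {poly R}) : 0 <= rho ->
  pnorm rho (\sum_(i < n) F i) <= \sum_(i < n) pnorm rho (F i).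
Proof.
move=> r0; elim: n => [|n IH].
  by rewrite !big_ord0 -polyC0 pnormC normr0.
by rewrite !big_ord_recr /= (le_trans (pnormD _ _ r0)) // lerD2r.
Qed.

Lemma pnorm_comp rho P Q : 0 <= rho ->
  pnorm rho (P \Po Q) <= pnorm (pnorm rho Q) P.
Proof.
move=> r0; rewrite comp_polyE.
apply: le_trans (pnorm_sum _ (fun i => P`_i *: Q ^+ i) r0) _.
rewrite /(pnorm (pnorm _ _)) /abs_poly horner_poly; apply: ler_sum => i _.
apply: le_trans (pnormZ _ _ r0) _; apply: ler_wpM2l => //; exact: pnormXn.
Qed.

(** Each monomial of degree i >= n satisfies s^i <= (s/rho)^n rho^i. This turns X-adic closeness
    into geometric decay at any s < rho. *)
Lemma pnorm_dvdX rho s n P : 0 < rho -> 0 <= s -> s <= rho -> 'X^n %| P ->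
  pnorm s P <= (s / rho) ^+ n * pnorm rho P.
Proof.
move=> r0 s0 sr /dvdpP[Q ->]; rewrite /pnorm !horner_coef mulr_sumr.
apply: ler_sum => i _; rewrite coef_abs_poly coefMXn; case: ltnP => h.
  by rewrite normr0 !mul0r mulr0.
rewrite mulrCA; apply: ler_wpM2l => //.
rewrite -[X in s ^+ X](subnKC h) -[X in rho ^+ X](subnKC h) !exprD mulrA -exprMn.
rewrite divfK ?gt_eqF //; apply: ler_wpM2l; first exact: exprn_ge0.
by apply: lerXn2r; rewrite ?nnegrE // ltW.
Qed.

Lemma dvdp_comp_sub P Q Q' : (Q - Q') %| (P \Po Q) - (P \Po Q').
Proof.
rewrite !comp_polyE -sumrB; elim/big_ind: _ => //.
  by move=> x y; exact: dvdp_add.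
move=> i _; by rewrite -mul_polyC -mul_polyC -mulrBr subrXX mulrCA dvdp_mulr.
Qed.

Lemma dvdpX P : ('X %| P) = (P`_0 == 0).
Proof. by rewrite -['X]subr0 -polyC0 dvdp_XsubCl /root horner_coef0. Qed.

Lemma dvdXn_le n k P : (k <= n)%N -> 'X^n %| P -> 'X^k %| P.
Proof. by move=> kn; apply: dvdp_trans; rewrite dvdp_exp2l. Qed.

Lemma coef_dvdXn n P : (forall i, (i < n)%N -> P`_i = 0) -> 'X^n %| P.
Proof.
move=> h; have -> : P = drop_poly n P * 'X^n.
  rewrite -[LHS](poly_take_drop n) (_ : take_poly n P = 0) ?add0r //.
  by apply/polyP => i; rewrite coef_take_poly coef0; case: ltnP => // /h.
exact: dvdp_mull.
Qed.

Lemma dvdXn_coef n P i : 'X^n %| P -> (i < n)%N -> P`_i = 0.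
Proof. by move=> /dvdpP[Q ->] h; rewrite coefMXn h. Qed.

End PolyNorm.

(** * Germs of analytic functions at 0 and their closure properties *)

Section Analytic.
Variable R : realType.
Implicit Types (f g : R -> R) (U V W : nat -> {poly R}) (rho : R).

(* Power series are encoded by X-adically Cauchy sequences of polynomials that
   stay bounded in the weighted l1 norm; the limit function is only observed
   at nonnegative arguments. *)
Definition adic_cauchy U := forall j, 'X^(j.+1) %| U j.+1 - U j.

Definition analytic0 f := exists U rho (K : R),
  [/\ 0 < rho, adic_cauchy U, forall j, pnorm rho (U j) <= K &
    forall s, 0 <= s < rho -> (U j).[s] @[j --> \oo] --> f s].

Lemma adic_cauchy_sub U i j : adic_cauchy U -> (i <= j)%N ->
  'X^(i.+1) %| U j - U i.
Proof.
move=> h; elim: j => [|j IH]; first by rewrite leqn0 => /eqP ->; rewrite subrr dvdp0.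
rewrite leq_eqVlt => /orP[/eqP ->|ij]; first by rewrite subrr dvdp0.
rewrite -(subrKA (U j)); apply: dvdp_add; last exact: IH.
by apply: dvdXn_le (h j); rewrite ltnS.
Qed.

Lemma adic_cauchy_dist U rho (K s : R) i j : adic_cauchy U -> 0 < rho ->
  (forall j, pnorm rho (U j) <= K) -> 0 <= s -> s <= rho -> (i <= j)%N ->
  `|(U j).[s] - (U i).[s]| <= (s / rho) ^+ i.+1 * (K + K).
Proof.
move=> h r0 hK s0 sr ij; rewrite -hornerN -hornerD.
apply: le_trans (horner_le_pnorm _ s0) _.
apply: le_trans (pnorm_dvdX r0 s0 sr (adic_cauchy_sub h ij)) _.
apply: ler_wpM2l; first by rewrite exprn_ge0 // divr_ge0 // ltW.
by apply: le_trans (pnormB _ _ (ltW r0)) _; exact: lerD.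
Qed.

Lemma adic_cauchy_cvg U rho (K s : R) : adic_cauchy U -> 0 < rho ->
  (forall j, pnorm rho (U j) <= K) -> 0 <= s < rho ->
  cvgn (fun j => (U j).[s]).
Proof.
move=> h r0 hK /andP[s0 sr].
set u := fun j => (U j).[s].
have -> : u = (fun n => u 0%N + series (telescope u) n).
  by apply/funext => n; exact: eq_sum_telescope.
apply: is_cvgD; first exact: is_cvg_cst.
apply: normed_cvg.
apply: (@series_le_cvg _ _ (geometric ((s / rho) * (K + K)) (s / rho))).
- by move=> n /=.
- move=> n /=; apply: mulr_ge0; last by rewrite exprn_ge0 // divr_ge0 // ltW.
  apply: mulr_ge0; first by rewrite divr_ge0 // ltW.
  by rewrite addr_ge0 // (le_trans (pnorm_ge0 (U 0%N) (ltW r0)) (hK _)).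
- move=> n /=; rewrite /telescope /u.
  apply: le_trans (adic_cauchy_dist h r0 hK s0 (ltW sr) (leqnSn n)) _.
  by rewrite exprS mulrAC.
apply: is_cvg_geometric_series.
by rewrite ger0_norm ?divr_ge0 ?(ltW r0) // ltr_pdivrMr // mul1r.
Qed.

(** The bound by [K] survives in the limit; it is what later selects the nonnegative branch of the
    square root. *)
Lemma analytic0_lim U rho (K : R) : adic_cauchy U -> 0 < rho ->
  (forall j, pnorm rho (U j) <= K) ->
  exists f, [/\ analytic0 f,
    forall s, 0 <= s < rho -> `|f s| <= K &
    forall s, 0 <= s < rho -> (U j).[s] @[j --> \oo] --> f s].
Proof.
move=> h r0 hK.
have cvgf s : 0 <= s < rho -> (U j).[s] @[j --> \oo] --> limn (fun j => (U j).[s]).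
  by move=> hs; apply: (adic_cauchy_cvg h r0 hK hs).
exists (fun s => limn (fun j => (U j).[s])); split=> //.
- by exists U, rho, K; split.
- move=> s hs; have c := cvgf s hs.
  have s0 : 0 <= s by case/andP: hs.
  have n : (`|(U j).[s]| @[j --> \oo] --> `|limn (fun j => (U j).[s])|).
    exact: (cvg_norm c).
  rewrite -(cvg_lim _ n) //; apply: limr_le; first by apply/cvg_ex; eexists; exact: n.
  apply: nearW => j; apply: le_trans (horner_le_pnorm _ s0) _.
  by apply: le_trans (pnorm_le _ s0 _) (hK j); case/andP: hs => _ /ltW.
Qed.

Lemma analytic0_ext f g (e : R) : 0 < e -> (forall s, 0 <= s < e -> f s = g s) ->
  analytic0 f -> analytic0 g.
Proof.
move=> e0 fg [U [rho [K [r0 h hK c]]]].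
exists U, (Num.min rho e), K; split=> //.
- by rewrite lt_min r0.
- move=> j; apply: le_trans (hK j); apply: pnorm_le; first by rewrite le_min !ltW.
  by rewrite ge_min lexx.
- move=> s /andP[s0]; rewrite lt_min => /andP[sr se].
  by rewrite -fg ?s0 //; apply: c; rewrite s0.
Qed.

Lemma analytic0_horner (P : {poly R}) : analytic0 (fun s => P.[s]).
Proof.
exists (fun=> P), 1, (pnorm 1 P); split=> //; first by move=> j; rewrite subrr dvdp0.
by move=> s _; exact: cvg_cst.
Qed.

Lemma analytic0_cst (c : R) : analytic0 (fun=> c).
Proof.
by apply: (analytic0_ext ltr01 _ (analytic0_horner c%:P)) => s _; rewrite hornerC.
Qed.

Lemma analytic0_id : analytic0 (fun s => s).
Proof.
by apply: (analytic0_ext ltr01 _ (analytic0_horner 'X)) => s _; rewrite hornerX.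
Qed.

Lemma analytic0D f g : analytic0 f -> analytic0 g -> analytic0 (fun s => f s + g s).
Proof.
move=> [U [r [K [r0 h hK c]]]] [U' [r' [K' [r0' h' hK' c']]]].
have m0 : 0 < Num.min r r' by rewrite lt_min r0.
exists (fun j => U j + U' j), (Num.min r r'), (K + K'); split=> //.
- by move=> j; rewrite opprD addrACA dvdp_add.
- move=> j; apply: le_trans (pnormD _ _ (ltW m0)) _; apply: lerD.
    by apply: le_trans (hK j); apply: pnorm_le; rewrite ?(ltW m0) // ge_min lexx.
  by apply: le_trans (hK' j); apply: pnorm_le; rewrite ?(ltW m0) // ge_min lexx orbT.
- move=> s /andP[s0]; rewrite lt_min => /andP[sr sr'].
  under eq_fun do rewrite hornerD.
  by apply: cvgD; [apply: c|apply: c']; rewrite s0.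
Qed.

Lemma analytic0M f g : analytic0 f -> analytic0 g -> analytic0 (fun s => f s * g s).
Proof.
move=> [U [r [K [r0 h hK c]]]] [U' [r' [K' [r0' h' hK' c']]]].
have m0 : 0 < Num.min r r' by rewrite lt_min r0.
exists (fun j => U j * U' j), (Num.min r r'), (K * K'); split=> //.
- move=> j; have -> : U j.+1 * U' j.+1 - U j * U' j =
    U' j.+1 * (U j.+1 - U j) + U j * (U' j.+1 - U' j) by ring.
  by apply: dvdp_add; apply: dvdp_mull.
- move=> j; apply: le_trans (pnormM _ _ (ltW m0)) _.
  apply: ler_pM; rewrite ?pnorm_ge0 ?(ltW m0) //.
    by apply: le_trans (hK j); apply: pnorm_le; rewrite ?(ltW m0) // ge_min lexx.
  by apply: le_trans (hK' j); apply: pnorm_le; rewrite ?(ltW m0) // ge_min lexx orbT.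
- move=> s /andP[s0]; rewrite lt_min => /andP[sr sr'].
  under eq_fun do rewrite hornerM.
  by apply: cvgM; [apply: c|apply: c']; rewrite s0.
Qed.

Lemma analytic0X f n : analytic0 f -> analytic0 (fun s => f s ^+ n).
Proof.
move=> hf; elim: n => [|n IH].
  by under eq_fun do rewrite expr0; exact: analytic0_cst.
by under eq_fun do rewrite exprS; exact: analytic0M.
Qed.

Lemma analytic0_sum (I : Type) (r : seq I) (F : I -> R -> R) :
  (forall i, analytic0 (F i)) -> analytic0 (fun s => \sum_(i <- r) F i s).
Proof.
move=> h; elim: r => [|i r IH].
  by under eq_fun do rewrite big_nil; exact: analytic0_cst.
by under eq_fun do rewrite big_cons; exact: analytic0D.
Qed.

Lemma analytic0Z f (c : R) : analytic0 f -> analytic0 (fun s => c * f s).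
Proof. by apply: analytic0M; exact: analytic0_cst. Qed.

Lemma analytic0_comp_horner f (P : {poly R}) :
  analytic0 f -> analytic0 (fun s => P.[f s]).
Proof.
move=> hf; under eq_fun do rewrite horner_coef.
by apply: analytic0_sum => i; apply: analytic0Z; exact: analytic0X.
Qed.

Lemma adic_cauchy_horner0 U j : adic_cauchy U -> (U j)`_0 = (U 0%N)`_0.
Proof.
move=> h; apply/eqP; rewrite -subr_eq0 -coefB; apply/eqP.
exact: dvdXn_coef (adic_cauchy_sub h (leq0n j)) _.
Qed.

Lemma analytic0_coef0 U rho f : adic_cauchy U -> 0 < rho ->
  (forall s, 0 <= s < rho -> (U j).[s] @[j --> \oo] --> f s) ->
  forall j, (U j)`_0 = f 0.
Proof.
move=> h r0 c j; rewrite adic_cauchy_horner0 //.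
have /c : 0 <= (0:R) < rho by rewrite lexx.
under eq_fun do rewrite horner_coef0 adic_cauchy_horner0 //.
by move=> c0; apply: (cvg_unique _ (@cvg_cst _ _ _ _ _) c0).
Qed.

(** With no constant term, shrinking the radius by a factor e shrinks the norm at least as much. The
    iterations below get their small factors from this. *)
Lemma pnorm_shrink (P : {poly R}) rho (e : R) : 0 < rho -> 0 <= e <= 1 -> P`_0 = 0 ->
  pnorm (e * rho) P <= e * pnorm rho P.
Proof.
move=> r0 /andP[e0 e1] P0.
have d1 : 'X^1 %| P.
  by rewrite expr1 dvdpX P0.
have := @pnorm_dvdX _ rho (e * rho) 1 P r0 _ _ d1.
rewrite expr1 mulfK ?gt_eqF //; apply; first by rewrite mulr_ge0 // ltW.
by rewrite ler_piMl // ltW.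
Qed.

(** A fixed point scheme in both topologies: each map preserves a ball of the norm and gains one
    power of X. [Phi] depends on j because it uses the j-th approximant of the data, and passing
    from j to j+1 alters it only from degree j+2 on. Contraction is required only among polynomials
    with the constant term of [W0], which the square root needs. *)
Lemma analytic0_iter (Phi : nat -> {poly R} -> {poly R}) (W0 : {poly R}) rho (K : R) :
  0 < rho -> pnorm rho W0 <= K ->
  (forall j P, pnorm rho P <= K -> pnorm rho (Phi j P) <= K) ->
  (forall j n (P Q : {poly R}), P`_0 = W0`_0 -> Q`_0 = W0`_0 ->
    'X^n %| P - Q -> 'X^(n.+1) %| Phi j P - Phi j Q) ->
  (forall j P, 'X^(j.+2) %| Phi j.+1 P - Phi j P) ->
  'X %| Phi 0%N W0 - W0 ->
  exists W f, [/\ analytic0 f, f 0 = W0`_0, forall j, W j.+1 = Phi j (W j),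
    forall s, 0 <= s < rho -> `|f s| <= K &
    forall s, 0 <= s < rho -> (W j).[s] @[j --> \oo] --> f s].
Proof.
move=> r0 hW0 hK hc hd h0.
pose W := fix W n := if n is n'.+1 then Phi n' (W n') else W0.
have WK j : pnorm rho (W j) <= K by elim: j => [|j IH] //=; exact: hK.
have W0c j : (W j)`_0 = W0`_0 /\ 'X^(j.+1) %| W j.+1 - W j.
  elim: j => [|j [IH0 IH]]; first by rewrite expr1.
  have W1 : (W j.+1)`_0 = W0`_0.
    by rewrite -IH0; apply/eqP; rewrite -subr_eq0 -coefB (dvdXn_coef IH).
  split=> //.
  have -> : W j.+2 - W j.+1 = (Phi j.+1 (W j.+1) - Phi j.+1 (W j)) +
     (Phi j.+1 (W j) - Phi j (W j)) by rewrite addrA subrK.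
  by apply: dvdp_add; [exact: hc | exact: hd].
have Wc : adic_cauchy W by move=> j; case: (W0c j).
have [f [af fK cf]] := analytic0_lim Wc r0 WK.
exists W, f; split=> //; exact: esym (analytic0_coef0 Wc r0 cf 0).
Qed.

Lemma cvg_shiftSn (u : R^nat) (l : R) : u @ \oo --> l -> (fun n => u n.+1) @ \oo --> l.
Proof. by rewrite cvg_shiftS. Qed.

Lemma cvgn_unique (u : R^nat) (a b : R) : u @ \oo --> a -> u @ \oo --> b -> a = b.
Proof. by move=> ua ub; apply: (cvg_unique _ ua ub). Qed.

(** The inverse is the fixed point of g = 1 + (1 - f) g. The radius is cut until 1 - f has norm at
    most 1/2, so the ball of radius 2 is preserved: 1 + 2/2 = 2. *)
Lemma analytic0V1 f : analytic0 f -> f 0 = 1 ->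
  exists2 rho, 0 < rho & analytic0 (fun s => (f s)^-1) /\
    forall s, 0 <= s < rho -> f s != 0.
Proof.
move=> [U [r [K [r0 h hK c]]]] f01.
have c0 j : (U j)`_0 = 1 by rewrite (analytic0_coef0 h r0 c).
pose K1 := 1 + K.
have K0 : 0 <= K by apply: le_trans (hK 0%N); exact: pnorm_ge0 (ltW r0).
have K10 : 0 < K1 by rewrite /K1; lra.
pose e := (2 * K1)^-1.
have e0 : 0 < e by rewrite invr_gt0 mulr_gt0.
have e1 : e <= 1 by rewrite /e invf_le1 ?mulr_gt0 // /K1; lra.
pose rho := e * r.
have rho0 : 0 < rho by rewrite mulr_gt0.
have rhor : rho <= r by rewrite ler_piMl // ltW.
have nU j : pnorm rho (1 - U j) <= 2^-1.
  have -> : 2^-1 = e * K1 by rewrite /e; field; rewrite gt_eqF.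
  apply: le_trans (pnorm_shrink r0 _ _) _; first by rewrite ltW.
    by rewrite coefB c0 coef1 subrr.
  apply: ler_wpM2l; first exact: ltW.
  by apply: le_trans (pnormB _ _ (ltW r0)) _; rewrite pnorm1 lerD2l.
have XU j : 'X %| 1 - U j.
  by rewrite dvdpX coefB coef1 c0 subrr.
have rho0' := ltW rho0.
have [|||||W [g [ag _ gW _ cg]]] :=
   @analytic0_iter (fun j P => 1 + (1 - U j.+1) * P) 1 rho 2 rho0.
- by rewrite pnorm1; lra.
- move=> j P hP; apply: le_trans (pnormD _ _ rho0') _; rewrite pnorm1.
  have := le_trans (pnormM (1 - U j.+1) P rho0')
    (ler_pM (pnorm_ge0 _ rho0') (pnorm_ge0 _ rho0') (nU j.+1) hP).
  lra.
- move=> j n P Q _ _ PQ; rewrite opprD addrACA subrr add0r -mulrBr exprS.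
  exact: dvdp_mul.
- move=> j P; rewrite opprD addrACA subrr add0r -mulrBl opprB addrA.
  have -> : (1 - U j.+2 + U j.+1 - 1) * P = (U j.+2 - U j.+1) * - P by ring.
  by rewrite dvdp_mulr.
- by rewrite mulr1 addrAC subrr add0r.
have fg s : 0 <= s < rho -> f s * g s = 1.
  move=> hs.
  have hs' : 0 <= s < r by case/andP: hs => -> /= /lt_le_trans; apply.
  have cU : (U j.+1).[s] @[j --> \oo] --> f s by exact: (cvg_shiftSn (c _ hs')).
  have cW : (W j.+1).[s] @[j --> \oo] --> g s by exact: (cvg_shiftSn (cg _ hs)).
  have : (W j.+1).[s] @[j --> \oo] --> 1 + (1 - f s) * g s.
    under eq_fun do rewrite gW hornerD hornerM hornerD hornerN hornerC.
    apply: cvgD; first exact: cvg_cst.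
    apply: cvgM; last exact: cg.
    by apply: cvgB => //; exact: cvg_cst.
  move=> /(cvgn_unique cW); lra.
exists rho => //; split; last first.
  by move=> s /fg fg1; apply/eqP => f0; move: fg1; rewrite f0 mul0r => /eqP; rewrite eq_sym oner_eq0.
apply: (analytic0_ext rho0 _ ag) => s /fg fg1.
have f0 : f s != 0 by apply/eqP => f0; move: fg1; rewrite f0 mul0r => /eqP; rewrite eq_sym oner_eq0.
by apply: (mulfI f0); rewrite fg1 divff.
Qed.

Lemma analytic0V f : analytic0 f -> f 0 != 0 -> analytic0 (fun s => (f s)^-1).
Proof.
move=> af f0.
have af1 : analytic0 (fun s => (f 0)^-1 * f s) by exact: analytic0Z.
have [|rho rho0 [aV nz]] := analytic0V1 af1; first by rewrite mulVf.
apply: (analytic0_ext rho0 _ (analytic0Z (f 0)^-1 aV)) => s hs /=.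
have fs : f s != 0 by move: (nz _ hs); rewrite mulf_eq0 negb_or => /andP[].
by rewrite invfM invrK mulrA mulVf // mul1r.
Qed.

(** Writing the root as 1 + g gives g = (f - 1 - g^2)/2. Once f - 1 has norm at most 1, the unit
    ball is preserved, and |g| <= 1 makes 1 + g the nonnegative root. *)
Lemma analytic0_sqrt1 f : analytic0 f -> f 0 = 1 -> analytic0 (fun s => Num.sqrt (f s)).
Proof.
move=> [U [r [K [r0 h hK c]]]] f01.
have c0 j : (U j)`_0 = 1 by rewrite (analytic0_coef0 h r0 c).
pose K1 := 1 + K.
have K0 : 0 <= K by apply: le_trans (hK 0%N); exact: pnorm_ge0 (ltW r0).
have K10 : 0 < K1 by rewrite /K1; lra.
pose e := K1^-1.
have e0 : 0 < e by rewrite invr_gt0.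
have e1 : e <= 1 by rewrite /e invf_le1 // /K1; lra.
pose rho := e * r.
have rho0 : 0 < rho by rewrite mulr_gt0.
have rhor : rho <= r by rewrite ler_piMl // ltW.
have nU j : pnorm rho (U j - 1) <= 1.
  have hle : pnorm r (U j - 1) <= K1.
    by apply: le_trans (pnormB _ _ (ltW r0)) _; rewrite pnorm1 addrC lerD2l.
  apply: le_trans (pnorm_shrink r0 _ _) _; first by rewrite ltW.
    by rewrite coefB c0 coef1 subrr.
  apply: le_trans (ler_wpM2l (ltW e0) hle) _.
  by rewrite mulVf // gt_eqF.
have rho0' := ltW rho0.
have XU j : 'X %| U j - 1.
  by rewrite dvdpX coefB coef1 c0 subrr.
have [|||||W [g [ag _ gW gK cg]]] :=
   @analytic0_iter (fun j P => 2^-1 *: (U j.+1 - 1 - P ^+ 2)) 0 rho 1 rho0.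
- by rewrite -polyC0 pnormC normr0.
- move=> j P hP; apply: le_trans (pnormZ _ _ rho0') _.
  have h1 := le_trans (pnormM P P rho0')
    (ler_pM (pnorm_ge0 _ rho0') (pnorm_ge0 _ rho0') hP hP).
  have h2 := pnormB (U j.+1 - 1) (P * P) rho0'.
  have h3 := nU j.+1.
  rewrite ger0_norm ?invr_ge0 // expr2.
  move: (pnorm rho (_ - P * P)) h2 => x h2; lra.
- move=> j n P Q P0 Q0 PQ; rewrite -scalerBr -mul_polyC dvdp_mull //.
  (* The extra power of X comes from P + Q, whose constant term vanishes. *)
  have -> : U j.+1 - 1 - P ^+ 2 - (U j.+1 - 1 - Q ^+ 2) = (P + Q) * - (P - Q) by ring.
  rewrite exprS dvdp_mul ?dvdpNr //.
  by rewrite dvdpX coefD P0 Q0 coef0 addr0.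
- move=> j P; rewrite -scalerBr -mul_polyC dvdp_mull //.
  by have -> : U j.+2 - 1 - P ^+ 2 - (U j.+1 - 1 - P ^+ 2) = U j.+2 - U j.+1 by ring.
- by rewrite expr0n /= !subr0 -mul_polyC dvdp_mull.
have fg s : 0 <= s < rho -> f s = (1 + g s) ^+ 2.
  move=> hs.
  have hs' : 0 <= s < r by case/andP: hs => -> /= /lt_le_trans; apply.
  have cU : (U j.+1).[s] @[j --> \oo] --> f s by exact: (cvg_shiftSn (c _ hs')).
  have cW : (W j.+1).[s] @[j --> \oo] --> g s by exact: (cvg_shiftSn (cg _ hs)).
  have : (W j.+1).[s] @[j --> \oo] --> 2^-1 * (f s - 1 - g s * g s).
    under eq_fun do rewrite gW hornerZ expr2 hornerD hornerN hornerM hornerD hornerN hornerC.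
    apply: cvgM; first exact: cvg_cst.
    apply: cvgB; last by apply: cvgM; exact: cg.
    by apply: cvgB => //; exact: cvg_cst.
  move=> /(cvgn_unique cW); lra.
apply: (analytic0_ext rho0 _ (analytic0D (analytic0_cst 1) ag)) => s hs /=.
rewrite fg // sqrtr_sqr ger0_norm //.
by have := gK _ hs; rewrite ler_norml => /andP[]; lra.
Qed.

Lemma analytic0_sqrt f : analytic0 f -> 0 < f 0 -> analytic0 (fun s => Num.sqrt (f s)).
Proof.
move=> af f0.
have a1 : analytic0 (fun s => Num.sqrt ((f 0)^-1 * f s)).
  by apply: (analytic0_sqrt1 (analytic0Z _ af)); rewrite mulVf // gt_eqF.
apply: (analytic0_ext ltr01 _ (analytic0Z (Num.sqrt (f 0)) a1)) => s _ /=.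
by rewrite -sqrtrM ?ltW // mulrA divff ?gt_eqF // mul1r.
Qed.

Lemma horner_lt_near0 (P : {poly R}) (c : R) : P`_0 < c ->
  exists2 e, 0 < e & forall s, 0 <= s -> s <= e -> P.[s] < c.
Proof.
rewrite -horner_coef0 => P0.
have /cvgr_lt /(_ _ P0) /nbhs_ballP [e /= e0 he] := @continuous_horner R P 0.
exists (e / 2); first by rewrite divr_gt0.
move=> s s0 se; apply: he; rewrite /ball /= sub0r normrN ger0_norm //; lra.
Qed.

(* The equation y A(s^2 y) = B(s^2 y) is the fixed point equation
   y = B(s^2 y) + y (1 - A)(s^2 y), which contracts the X-adic distance. *)
Lemma analytic0_implicit (A B : {poly R}) : A`_0 = 1 -> B`_0 = 1 ->
  exists y rho, [/\ analytic0 y, 0 < rho, y 0 = 1 &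
    forall s, 0 <= s < rho -> y s * A.[s ^+ 2 * y s] = B.[s ^+ 2 * y s]].
Proof.
move=> A0 B0; pose D := 1 - A.
(* The bounds 3/2 and 1/4 preserve the ball of radius 2, since 3/2 + 2/4 = 2; they hold near 0
   because the constant terms are 1 and 0. *)
have [|e1 e10 he1] := @horner_lt_near0 (abs_poly B) (3 / 2).
  by rewrite coef_abs_poly B0 normr1; lra.
have [|e2 e20 he2] := @horner_lt_near0 (abs_poly D) (1 / 4).
  by rewrite coef_abs_poly coefB coef1 A0 subrr normr0; lra.
pose rho := Num.min 1 (Num.min e1 e2 / 2).
have rho0 : 0 < rho by rewrite !lt_min ltr01 /= divr_gt0 // lt_min e10.
have rho0' := ltW rho0.
have rho1 : rho <= 1 by rewrite ge_min lexx.
have rhoe : rho <= Num.min e1 e2 / 2 by rewrite ge_min lexx orbT.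
have rho2 : rho ^+ 2 * 2 <= Num.min e1 e2.
  have : rho ^+ 2 <= rho by rewrite expr2 ler_piMl.
  lra.
have nX P : pnorm rho P <= 2 -> pnorm rho ('X^2 * P) <= Num.min e1 e2.
  move=> hP; apply: le_trans (pnormM _ _ rho0') _; apply: le_trans rho2.
  apply: ler_pM; rewrite ?pnorm_ge0 //.
  by apply: le_trans (pnormXn _ _ rho0') _; rewrite pnormX.
have nB P : pnorm rho P <= 2 -> pnorm rho (B \Po ('X^2 * P)) <= 3 / 2.
  move=> /nX hP; apply: le_trans (pnorm_comp _ _ rho0') _; apply: ltW; apply: he1.
    exact: pnorm_ge0.
  by apply: le_trans hP _; rewrite ge_min lexx.
have nD P : pnorm rho P <= 2 -> pnorm rho (D \Po ('X^2 * P)) <= 1 / 4.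
  move=> /nX hP; apply: le_trans (pnorm_comp _ _ rho0') _; apply: ltW; apply: he2.
    exact: pnorm_ge0.
  by apply: le_trans hP _; rewrite ge_min lexx orbT.
have dvdc (E P Q : {poly R}) n : 'X^n %| P - Q ->
    'X^(n.+1) %| (E \Po ('X^2 * P)) - (E \Po ('X^2 * Q)).
  move=> h; apply: dvdp_trans (dvdp_comp_sub _ _ _); rewrite -mulrBr exprS.
  by apply: dvdp_mul => //; rewrite expr2 dvdp_mulr.
have XD P : 'X %| D \Po ('X^2 * P).
  rewrite dvdpX -horner_coef0 horner_comp hornerM hornerXn.
  by rewrite expr0n mul0r horner_coef0 coefB coef1 A0 subrr.
have [|||||W [y [ay y0 gW _ cy]]] := @analytic0_iter
  (fun j P => (B \Po ('X^2 * P)) + P * (D \Po ('X^2 * P))) 1 rho 2 rho0.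
- by rewrite pnorm1; lra.
- move=> j P hP; apply: le_trans (pnormD _ _ rho0') _.
  have h1 := nB _ hP.
  have := le_trans (pnormM P (D \Po ('X^2 * P)) rho0')
    (ler_pM (pnorm_ge0 _ rho0') (pnorm_ge0 _ rho0') hP (nD _ hP)).
  lra.
- move=> j n P Q _ _ PQ.
  have -> : (B \Po 'X^2 * P) + P * (D \Po 'X^2 * P) -
     ((B \Po 'X^2 * Q) + Q * (D \Po 'X^2 * Q)) =
     ((B \Po 'X^2 * P) - (B \Po 'X^2 * Q)) + ((D \Po 'X^2 * P) * (P - Q)
      + Q * ((D \Po 'X^2 * P) - (D \Po 'X^2 * Q))) by ring.
  apply: dvdp_add; first exact: dvdc.
  apply: dvdp_add; last by rewrite dvdp_mull // dvdc.
  by rewrite exprS dvdp_mul.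
- by move=> j P; rewrite subrr dvdp0.
- rewrite mul1r addrAC; apply: dvdp_add => //.
  rewrite dvdpX -horner_coef0 hornerD hornerN horner_comp hornerM hornerXn.
  by rewrite expr0n mul0r horner_coef0 B0 hornerC subrr.
exists y, rho; split=> //; first by rewrite y0 coef1.
move=> s hs.
have cW : (W j.+1).[s] @[j --> \oo] --> y s by exact: (cvg_shiftSn (cy _ hs)).
have cP (P : {poly R}) : (P \Po ('X^2 * W j)).[s] @[j --> \oo] --> P.[s ^+ 2 * y s].
  under eq_fun do rewrite horner_comp hornerM hornerXn.
  apply: (cvg_comp _ (fun x => P.[x])); last exact: continuous_horner.
  by apply: cvgM; [exact: cvg_cst | exact: cy].
have : (W j.+1).[s] @[j --> \oo] --> B.[s ^+ 2 * y s] + y s * D.[s ^+ 2 * y s].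
  under eq_fun do rewrite gW hornerD hornerM.
  by apply: cvgD; [exact: cP | apply: cvgM; [exact: cy | exact: cP]].
move=> /(cvgn_unique cW).
rewrite /D hornerD hornerN hornerC mulrBr mulr1; lra.
Qed.

(** One-sided, with s = 0 excluded: there [zf] is a default value. *)
Definition near0_bigO (n : nat) f := exists C e : R,
  0 < e /\ forall s, 0 < s < e -> `|f s| <= C * s ^+ n.

(** At the lowest nonzero coefficient, of degree k < n, the quotient Q = P/X^k would satisfy |Q(s)|
    <= C s although Q(0) is nonzero. *)
Lemma coef_near0_bigO (P : {poly R}) n : near0_bigO n (fun s => P.[s]) ->
  forall k, (k < n)%N -> P`_k = 0.
Proof.
move=> [C [e [e0 hP]]] k; elim/ltn_ind: k => k IH kn.
have dP : 'X^k %| P by apply: coef_dvdXn => i ik; apply: IH => //; apply: ltn_trans kn.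
have /dvdpP[Q PQ] := dP.
rewrite PQ coefMXn ltnn subnn; apply/eqP; apply: contraT => Q0.
(* Comparing squares avoids a case distinction on the sign of Q(0). *)
have [|e' e'0 he'] := @horner_lt_near0 ((C *: 'X) ^+ 2 - Q ^+ 2) 0.
  rewrite -horner_coef0 hornerD hornerN !horner_exp hornerZ hornerX mulr0 expr0n sub0r.
  by rewrite horner_coef0 oppr_lt0 exprn_even_gt0.
pose s := Num.min 1 (Num.min (e / 2) e').
have s0 : 0 < s by rewrite !lt_min ltr01 e'0 andbT divr_gt0.
have s1 : s <= 1 by rewrite ge_min lexx.
have se : s < e by rewrite 2!gt_min; apply/orP; right; apply/orP; left; lra.
have se' : s <= e' by rewrite !ge_min lexx !orbT.
have := he' _ (ltW s0) se'.
rewrite hornerD hornerN !horner_exp hornerZ hornerX subr_lt0 ltNge.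
suff -> : Q.[s] ^+ 2 <= (C * s) ^+ 2 by [].
have hPs : `|P.[s]| <= C * s ^+ n by apply: hP; rewrite s0.
have hQ : `|Q.[s]| <= C * s.
  have C0 : 0 <= C.
    have := le_trans (normr_ge0 _) hPs; rewrite pmulr_lge0 ?exprn_gt0 //.
  have sk : 0 < s ^+ k by rewrite exprn_gt0.
  rewrite -(ler_pM2r sk) -[X in _ * X](ger0_norm (ltW sk)) -normrM.
  have := hPs; rewrite {1}PQ hornerM hornerXn => /le_trans; apply.
  rewrite -mulrA -exprS; apply: ler_wpM2l => //.
  by apply: ler_wiXn2l => //; exact: ltW.
rewrite -(real_normK (num_real Q.[s])).
by apply: lerXn2r; rewrite ?nnegrE // (le_trans _ hQ).
Qed.

(** A Taylor remainder estimate, obtained by letting j tend to infinity in [adic_cauchy_dist]. *)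
Lemma adic_limit_dist U rho (K : R) f n s : adic_cauchy U -> 0 < rho ->
  (forall j, pnorm rho (U j) <= K) ->
  (forall s, 0 <= s < rho -> (U j).[s] @[j --> \oo] --> f s) ->
  0 <= s < rho -> `|f s - (U n).[s]| <= (K + K) / rho ^+ n.+1 * s ^+ n.+1.
Proof.
move=> h r0 hK c cs; have /andP[s0 sr] := cs.
have cn : (`|(U j).[s] - (U n).[s]| @[j --> \oo] --> `|f s - (U n).[s]|).
  by apply: cvg_norm; apply: cvgB; [exact: c | exact: cvg_cst].
rewrite -(cvg_lim _ cn) //; apply: limr_le; first by apply/cvg_ex; eexists; exact: cn.
near=> j.
have nj : (n <= j)%N by near: j; exact: nbhs_infty_ge.
apply: le_trans (adic_cauchy_dist h r0 hK s0 (ltW sr) nj) _.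
by rewrite expr_div_n [leLHS]mulrC mulrA mulrAC.
Unshelve. all: by end_near.
Qed.

(** The coefficient of X^k is constant in [U j] from j = k on, hence the diagonal choice of [a]. The
    last clause lets coefficients be read off any polynomial approximation of sufficient order. *)
Lemma analytic0_power_series f : analytic0 f -> exists (a : nat -> R) (eps : R),
  [/\ 0 < eps,
   forall s, 0 < s < eps -> series (fun k => a k * s ^+ k) @ \oo --> f s &
   forall n (Q : {poly R}), near0_bigO n (fun s => f s - Q.[s]) ->
     forall k, (k < n)%N -> a k = Q`_k].
Proof.
move=> [U [r [K [r0 h hK c]]]].
pose a k := (U k)`_k.
have ak j k : (k <= j)%N -> (U j)`_k = a k.
  move=> kj; apply/eqP; rewrite -subr_eq0 -coefB; apply/eqP.
  exact: dvdXn_coef (adic_cauchy_sub h kj) _.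
exists a, r; split=> //.
- move=> s /andP[s0 sr].
  have s0' := ltW s0.
  have q1 : `|s / r| < 1 by rewrite ger0_norm ?divr_ge0 // ?ltW // ltr_pdivrMr // mul1r.
  (* The n-th partial sum is the truncation of [U n] below degree n, so the difference is divisible
     by X^n. *)
  have bnd n : `|(U n).[s] - series (fun k => a k * s ^+ k) n| <= K * (s / r) ^+ n.
    have -> : series (fun k => a k * s ^+ k) n = (take_poly n (U n)).[s].
      rewrite /series /= horner_poly big_mkord; apply: eq_bigr => i _.
      by rewrite ak // ltnW.
    rewrite -[in X in X - _](poly_take_drop n (U n)) hornerD addrC addKr.
    apply: le_trans (horner_le_pnorm _ s0') _.
    apply: le_trans (pnorm_dvdX r0 s0' (ltW sr) (dvdp_mull _ (dvdpp _))) _.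
    rewrite mulrC; apply: ler_wpM2r; first by rewrite exprn_ge0 // divr_ge0 // ltW.
    apply: le_trans (hK n); apply: le_horner; first exact: ltW.
    move=> i; rewrite !coef_abs_poly coefMXn; case: ltnP => // ni; first by rewrite normr0.
    by rewrite coef_drop_poly subnK.
  have d0 : (U n).[s] - series (fun k => a k * s ^+ k) n @[n --> \oo] --> 0.
    apply/cvgr0Pnorm_le => e e0.
    have g := @cvg_geometric R K _ q1.
    have /cvgr0_norm_le /(_ _ e0) := g.
    apply: filterS => n; apply: le_trans; apply: le_trans (bnd n) _; exact: ler_norm.
  have cs : 0 <= s < r by rewrite s0' sr.
  have -> : series (fun k => a k * s ^+ k) =
      (fun n => (U n).[s] - ((U n).[s] - series (fun k => a k * s ^+ k) n)).
    by apply/funext => n; rewrite opprB addrC subrK.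
  by rewrite -[f s]subr0; apply: cvgB => //; exact: c.
- move=> [//|n] Q [C [e [e0 hC]]] k kn.
  rewrite -(ak n) //; apply/eqP; rewrite -subr_eq0 -coefB; apply/eqP.
  apply: (@coef_near0_bigO _ n.+1) => //.
  exists ((K + K) / r ^+ n.+1 + C), (Num.min r e); rewrite lt_min r0 e0; split=> // s.
  rewrite lt_min => /and3P[s0 sr se].
  have cs : 0 <= s < r by rewrite (ltW s0) sr.
  rewrite hornerD hornerN.
  have -> : (U n).[s] - Q.[s] = ((U n).[s] - f s) + (f s - Q.[s]) by ring.
  apply: le_trans (ler_normD _ _) _; rewrite mulrDl; apply: lerD; last first.
    by apply: hC; rewrite s0.
  by rewrite distrC; exact: (adic_limit_dist n h r0 hK c cs).
Qed.

End Analytic.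

(** * Derivative rules for functions in pointwise form *)

Section Derivatives.
Variable R : realType.
Implicit Types (f g : R -> R) (x : R).

Lemma is_derive_funM f g x (df dg : R) : is_derive x 1 f df -> is_derive x 1 g dg ->
  is_derive x 1 (fun y => f y * g y) (df * g x + f x * dg).
Proof.
move=> hf hg; apply: is_derive_eq (is_deriveM hf hg) _.
by rewrite /GRing.scale /= addrC mulrC.
Qed.

Lemma is_derive_funD f g x (df dg : R) : is_derive x 1 f df -> is_derive x 1 g dg ->
  is_derive x 1 (fun y => f y + g y) (df + dg).
Proof. by move=> hf hg; exact: is_deriveD. Qed.

Lemma is_derive_funZ f x (c df : R) : is_derive x 1 f df ->
  is_derive x 1 (fun y => c * f y) (c * df).
Proof.
move=> hf; apply: is_derive_eq (is_derive_funM (is_derive_cst c x 1) hf) _.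
by rewrite mul0r add0r.
Qed.

Lemma is_derive_fun_sum (I : Type) (r : seq I) (F : I -> R -> R) (dF : I -> R) x :
  (forall i, is_derive x 1 (F i) (dF i)) ->
  is_derive x 1 (fun y => \sum_(i <- r) F i y) (\sum_(i <- r) dF i).
Proof.
move=> h; elim: r => [|i r IH].
  under eq_fun do rewrite big_nil.
  by rewrite big_nil; exact: is_derive_cst.
under eq_fun do rewrite big_cons.
by rewrite big_cons; exact: is_derive_funD.
Qed.

Lemma is_derive_funXn n x : is_derive x 1 (fun y : R => y ^+ n) (n%:R * x ^+ n.-1).
Proof.
have -> : (fun y : R => y ^+ n) = horner 'X^n by apply/funext => y; rewrite hornerXn.
by apply: is_derive_eq (is_derive_poly _ _) _; rewrite derivXn hornerMn hornerXn mulr_natl.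
Qed.

Lemma is_derive_funV x : x != 0 -> is_derive x 1 (fun y : R => y^-1) (- x ^- 2).
Proof.
move=> x0; apply: is_derive_eq (is_deriveV x0 (is_derive_id x 1)) _.
by rewrite /GRing.scale /= mulr1.
Qed.

Lemma is_derive_fun_expR (c : R) x : is_derive x 1 (fun y => expR (c * y)) (c * expR (c * x)).
Proof.
apply: is_derive_eq (is_derive1_comp (is_derive_expR (c * x))
  (is_derive_funZ c (is_derive_id x 1))) _.
by rewrite mulr1 mulrC.
Qed.

Lemma is_derive_fun_ln f x (df : R) : 0 < f x -> is_derive x 1 f df ->
  is_derive x 1 (fun y => ln (f y)) (df / f x).
Proof.
move=> f0 hf; apply: is_derive_eq (is_derive1_comp (is_derive1_ln f0) hf) _.
by rewrite mulrC.
Qed.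

End Derivatives.

(** * Incomplete exponential moments *)

Section Moments.
Variable R : realType.
Implicit Types (x c : R) (k : nat).

(* The integral of y ^ k exp (- c y) over [x, +oo), via the recursion given by
   integration by parts. *)
Fixpoint emom k x c : R := match k with
  | 0 => c^-1 * expR (- (c * x))
  | k'.+1 => c^-1 * (k%:R * emom k' x c + x ^+ k * expR (- (c * x)))
  end.

Lemma is_derive_emom_l k x c : c != 0 ->
  is_derive x 1 (fun y => emom k y c) (- (x ^+ k * expR (- (c * x)))).
Proof.
have hE : is_derive x 1 (fun y => expR (- (c * y))) (- c * expR (- (c * x))).
  by under eq_fun do rewrite -mulNr; rewrite -mulNr; exact: is_derive_fun_expR.
move=> c0; elim: k => [|k IH] /=.
  apply: is_derive_eq (is_derive_funZ _ hE) _.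
  by field.
apply: is_derive_eq (is_derive_funZ _ (is_derive_funD (is_derive_funZ _ IH)
  (is_derive_funM (is_derive_funXn k.+1 x) hE))) _.
rewrite /= !exprS; move: (x ^+ k) (expR _) => u v; by field.
Qed.

Lemma is_derive_emom_r k x c : c != 0 ->
  is_derive c 1 (emom k x) (- emom k.+1 x c).
Proof.
move=> c0.
have hE : is_derive c 1 (fun y => expR (- (y * x))) (- x * expR (- (c * x))).
  under eq_fun do rewrite mulrC -mulNr.
  by rewrite -[in X in is_derive _ _ _ X](mulrC x) -mulNr; exact: is_derive_fun_expR.
have hV := is_derive_funV c0.
elim: k => [|k IH].
  apply: is_derive_eq (is_derive_funM hV hE) _.
  by rewrite /= expr1 mul1r; field.
apply: is_derive_eq (is_derive_funM hV
   (is_derive_funD (is_derive_funZ _ IH) (is_derive_funZ _ hE))) _.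
rewrite /= !exprS -[k.+2%:R]natr1 -[k.+1%:R]natr1.
move: (x ^+ k) (expR _) (emom _ _ _) (k%:R) => u v w n; by field.
Qed.

Lemma emom_cvg0 k c : 0 < c -> emom k x c @[x --> +oo] --> 0.
Proof.
move=> c0.
(* Bounding exp(cx) below by (cx)^(n+1)/(n+1)!, one degree more than the numerator, leaves a
   multiple of 1/x; this gives the threshold on x. *)
have base n : x ^+ n * expR (- (c * x)) @[x --> +oo] --> 0.
  apply/cvgr0Pnorm_le => e e0.
  near=> x.
  have x0 : 0 < x by near: x; apply: nbhs_pinfty_gt; exact: num_real.
  have cx0 : 0 <= c * x by rewrite mulr_ge0 // ltW.
  have hx : (n.+1)`!%:R / c ^+ n.+1 / e <= x.
    by near: x; apply: nbhs_pinfty_ge; exact: num_real.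
  rewrite ger0_norm; last by rewrite mulr_ge0 ?expR_ge0 // exprn_ge0 // ltW.
  rewrite expRN ler_pdivrMr ?expR_gt0 //.
  have h1 := expR_ge1Dxn n cx0.
  have f0 : 0 < (n.+1)`!%:R :> R by rewrite ltr0n fact_gt0.
  have h2 : (c * x) ^+ n.+1 / (n.+1)`!%:R <= expR (c * x) by lra.
  apply: le_trans (ler_wpM2l (ltW e0) h2).
  rewrite mulrA ler_pdivlMr // mulrC exprMn [x ^+ n.+1]exprSr.
  have xn : 0 < x ^+ n by rewrite exprn_gt0.
  have -> : e * (c ^+ n.+1 * (x ^+ n * x)) = (x * e * c ^+ n.+1) * x ^+ n by ring.
  rewrite ler_pM2r // -ler_pdivrMr ?exprn_gt0 // -ler_pdivrMr //.
elim: k => [|k IH] /=.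
  rewrite -(mulr0 c^-1); apply: cvgM; first exact: cvg_cst.
  by have := base 0%N; under eq_fun do rewrite expr0 mul1r.
have -> : 0 = c^-1 * (k.+1%:R * 0 + 0) :> R by rewrite mulr0 addr0 mulr0.
apply: cvgM; first exact: cvg_cst.
by apply: cvgD; [apply: cvgM => //; exact: cvg_cst | exact: base].
Unshelve. all: by end_near. Qed.

(** This is k! times the exponential series truncated after degree k; exp(-y) [(incexp k).[y]] is
    the upper incomplete gamma function at (k+1, y). *)
Fixpoint incexp k : {poly R} := match k with
  | 0 => 1
  | k'.+1 => k%:R *: incexp k' + 'X^k
  end.

Lemma emom_incexp k x c : c != 0 ->
  c ^+ k.+1 * emom k x c = expR (- (c * x)) * (incexp k).[c * x].
Proof.
move=> c0; elim: k => [|k IH] /=.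
  by rewrite hornerC expr1 mulr1 mulrA divff // mul1r.
rewrite hornerD hornerZ hornerXn exprS mulrA [c * _]mulrC mulfK //.
by rewrite mulrDr mulrCA IH mulrCA exprMn; ring.
Qed.

Lemma incexp0 k : (incexp k)`_0 = k`!%:R.
Proof.
elim: k => [|k IH] /=; first by rewrite coefC.
by rewrite coefD coefZ coefXn IH addr0 factS natrM.
Qed.

Lemma deriv_incexp k : (incexp k)^`() = incexp k - 'X^k.
Proof.
elim: k => [|k IH] /=; first by rewrite derivC expr0 subrr.
rewrite derivD derivZ derivXn IH addrK scalerBr /=.
by rewrite !scaler_nat subrK.
Qed.

(** The function equals k! at 0 and its derivative -z^k exp(-z) is at most y^k in size on [0, y], so
    the mean value theorem applies. *)
Lemma expN_incexp_dist k (y : R) : 0 <= y ->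
  `|expR (- y) * (incexp k).[y] - k`!%:R| <= y ^+ k.+1.
Proof.
move=> y0.
have D (z : R) : is_derive z 1 (fun y => expR (- y) * (incexp k).[y]) (- (z ^+ k * expR (- z))).
  have hE : is_derive z 1 (fun y : R => expR (- y)) (- 1 * expR (- z)).
    under eq_fun do rewrite -mulN1r.
    by apply: is_derive_eq (is_derive_fun_expR (-1) z) _; rewrite !mulN1r.
  apply: is_derive_eq (is_derive_funM hE (is_derive_poly (incexp k) z)) _.
  by rewrite deriv_incexp hornerD hornerN hornerXn; ring.
have [|z zy E] := @MVT_segment R (fun y => expR (- y) * (incexp k).[y])
   (fun z => - (z ^+ k * expR (- z))) 0 y y0 (fun z _ => D z).
  by apply: derivable_within_continuous => z _; case: (D z).
move: E; rewrite oppr0 expR0 mul1r horner_coef0 incexp0 addr0 => ->.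
move: zy; rewrite in_itv /= => /andP[z0 zy].
rewrite normrM normrN (ger0_norm y0) ger0_norm ?mulr_ge0 ?exprn_ge0 ?expR_ge0 //.
rewrite exprSr; apply: ler_wpM2r => //.
rewrite -[y ^+ k]mulr1; apply: ler_pM; rewrite ?exprn_ge0 ?expR_ge0 //.
  by apply: lerXn2r.
by rewrite -expR0 ler_expR oppr_le0.
Qed.

End Moments.

(** * Calculus of one-sided error terms at 0 *)

Section BigO.
Variable R : realType.
Implicit Types (f g : R -> R) (n : nat).

Lemma near0_bigO_ext n f g (e : R) : 0 < e -> (forall s, 0 < s < e -> f s = g s) ->
  near0_bigO n f -> near0_bigO n g.
Proof.
move=> e0 fg [C [e' [e'0 h]]]; exists C, (Num.min e e'); rewrite lt_min e0 e'0.
by split=> // s; rewrite lt_min => /and3P[s0 se se']; rewrite -fg ?s0 //; apply: h; rewrite s0.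
Qed.

Lemma near0_bigOD n f g : near0_bigO n f -> near0_bigO n g ->
  near0_bigO n (fun s => f s + g s).
Proof.
move=> [C [e [e0 h]]] [C' [e' [e'0 h']]]; exists (C + C'), (Num.min e e').
rewrite lt_min e0 e'0; split=> // s; rewrite lt_min => /and3P[s0 se se'].
apply: le_trans (ler_normD _ _) _; rewrite mulrDl.
by apply: lerD; [apply: h|apply: h']; rewrite s0.
Qed.

Lemma near0_bigOM n k f g : near0_bigO n f -> near0_bigO k g ->
  near0_bigO (n + k) (fun s => f s * g s).
Proof.
move=> [C [e [e0 h]]] [C' [e' [e'0 h']]]; exists (C * C'), (Num.min e e').
rewrite lt_min e0 e'0; split=> // s; rewrite lt_min => /and3P[s0 se se'].
rewrite normrM exprD mulrACA.
by apply: ler_pM => //; [apply: h|apply: h']; rewrite s0.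
Qed.

Lemma near0_bigO_cst (c : R) : near0_bigO 0 (fun=> c).
Proof. by exists `|c|, 1; split=> // s _; rewrite expr0 mulr1. Qed.

Lemma near0_bigOZ n f (c : R) : near0_bigO n f -> near0_bigO n (fun s => c * f s).
Proof. exact: (near0_bigOM (near0_bigO_cst c)). Qed.

Lemma near0_bigON n f : near0_bigO n f -> near0_bigO n (fun s => - f s).
Proof. by move=> [C [e [e0 h]]]; exists C, e; split=> // s /h; rewrite normrN. Qed.

Lemma near0_bigOB n f g : near0_bigO n f -> near0_bigO n g ->
  near0_bigO n (fun s => f s - g s).
Proof. by move=> hf hg; apply: near0_bigOD hf _; exact: near0_bigON. Qed.

Lemma near0_bigOMb n f g : near0_bigO n f -> near0_bigO 0 g ->
  near0_bigO n (fun s => f s * g s).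
Proof. by move=> hf hg; rewrite -(addn0 n); exact: near0_bigOM. Qed.

Lemma near0_bigO_id : near0_bigO 1 (fun s : R => s).
Proof.
by exists 1, 1; split=> // s /andP[s0 _]; rewrite expr1 mul1r ger0_norm // ltW.
Qed.

Lemma near0_bigOX n k f : near0_bigO n f -> near0_bigO (n * k) (fun s => f s ^+ k).
Proof.
move=> h; elim: k => [|k IH].
  by rewrite muln0; under eq_fun do rewrite expr0; exact: near0_bigO_cst.
by rewrite mulnS; under eq_fun do rewrite exprS; exact: near0_bigOM.
Qed.

Lemma near0_bigO_le n k f : (n <= k)%N -> near0_bigO k f -> near0_bigO n f.
Proof.
move=> nk [C [e [e0 h]]]; exists `|C|, (Num.min 1 e); rewrite lt_min ltr01 e0; split=> // s.
rewrite lt_min => /and3P[s0 s1 se]; apply: (@le_trans _ _ (`|C| * s ^+ k)).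
  apply: le_trans (h s _) _; first by rewrite s0.
  by rewrite ler_wpM2r ?ler_norm // exprn_ge0 // ltW.
by apply: ler_wpM2l => //; apply: ler_wiXn2l => //; exact: ltW.
Qed.

Lemma near0_bigO_sum (I : Type) (r : seq I) n (F : I -> R -> R) :
  (forall i, near0_bigO n (F i)) -> near0_bigO n (fun s => \sum_(i <- r) F i s).
Proof.
move=> h; elim: r => [|i r IH].
  under eq_fun do rewrite big_nil.
  exists 0, 1; split=> // s _; by rewrite normr0 mul0r.
by under eq_fun do rewrite big_cons; exact: near0_bigOD.
Qed.

Lemma near0_bigO_inv f (c e : R) : 0 < c -> 0 < e -> (forall s, 0 < s < e -> c <= f s) ->
  near0_bigO 0 (fun s => (f s)^-1).
Proof.
move=> c0 e0 h; exists c^-1, e; split=> // s /h cf; rewrite expr0 mulr1.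
rewrite ger0_norm ?invr_ge0 ?(le_trans (ltW c0)) // lef_pV2 //.
by rewrite posrE (lt_le_trans c0).
Qed.

Lemma near0_bigO_pos f (c : R) : 0 < c -> near0_bigO 1 (fun s => f s - c) ->
  exists2 e, 0 < e & forall s, 0 < s < e -> c / 2 <= f s.
Proof.
move=> c0 [C [e [e0 h]]].
have C1 : 0 < `|C| + 1 by rewrite ltr_wpDl.
exists (Num.min e (c / 2 / (`|C| + 1))).
  by rewrite lt_min e0 !divr_gt0.
move=> s; rewrite lt_min => /and3P[s0 se sc].
have := h s; rewrite s0 se => /(_ isT); rewrite expr1 ler_norml => /andP[h1 _].
move: sc; rewrite ltr_pdivlMr // => sc.
have : C * s <= `|C| * s by rewrite ler_wpM2r ?ler_norm // ltW.
lra.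
Qed.

Lemma analytic0_bigO0 f : analytic0 f -> near0_bigO 0 f.
Proof.
move=> [U [r [K [r0 h hK c]]]]; exists K, r; split=> // s /andP[s0 sr].
have cs : 0 <= s < r by rewrite ltW.
have n : (`|(U j).[s]| @[j --> \oo] --> `|f s|) by exact: (cvg_norm (c _ cs)).
rewrite -(cvg_lim _ n) // expr0 mulr1; apply: limr_le; first by apply/cvg_ex; eexists; exact: n.
apply: nearW => j; apply: le_trans (horner_le_pnorm _ (ltW s0)) _.
by apply: le_trans (pnorm_le _ (ltW s0) (ltW sr)) (hK j).
Qed.

Lemma near0_bigO_horner (P : {poly R}) f : near0_bigO 0 f -> near0_bigO 0 (fun s => P.[f s]).
Proof.
move=> hf; under eq_fun do rewrite horner_coef.
by apply: near0_bigO_sum => i; apply: near0_bigOZ; exact: (@near0_bigOX 0).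
Qed.

Lemma near0_bigO_dvdX (P : {poly R}) n f : near0_bigO 1 f -> 'X^n %| P ->
  near0_bigO n (fun s => P.[f s]).
Proof.
move=> hf /dvdpP[Q ->]; under eq_fun do rewrite hornerM hornerXn mulrC.
apply: near0_bigOMb; first by rewrite -[X in near0_bigO X _]mul1n; exact: near0_bigOX.
by apply: near0_bigO_horner; exact: near0_bigO_le hf.
Qed.

(** The error is ((f - f0) + (f0 - q g0) - (g - g0) q)/g. Here [q] may be a quotient of [f0] by [g0]
    only up to O(s^n), as happens with a truncated logarithmic derivative. *)
Lemma near0_bigO_div n f g f0 g0 (q : R -> R) (c e : R) : 0 < c -> 0 < e ->
  (forall s, 0 < s < e -> c <= g s) ->
  near0_bigO 0 q -> near0_bigO n (fun s => f s - f0 s) ->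
  near0_bigO n (fun s => g s - g0 s) ->
  near0_bigO n (fun s => f0 s - q s * g0 s) ->
  near0_bigO n (fun s => f s / g s - q s).
Proof.
move=> c0 e0 hg hq hf hgg h0.
have hn : near0_bigO n (fun s => (f s - f0 s) + (f0 s - q s * g0 s) - (g s - g0 s) * q s).
  by apply: near0_bigOB; [apply: near0_bigOD | apply: near0_bigOMb].
apply: (near0_bigO_ext e0 _ (near0_bigOMb hn (near0_bigO_inv c0 e0 hg))) => s hs.
have gs : g s != 0 by rewrite gt_eqF // (lt_le_trans c0) // hg.
by field.
Qed.

(** Rationalize: sqrt f - g = (f - g^2)/(sqrt f + g), with denominator at least c. *)
Lemma near0_bigO_sqrt n f g (c e : R) : 0 < c -> 0 < e ->
  (forall s, 0 < s < e -> c <= g s) -> (forall s, 0 < s < e -> 0 <= f s) ->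
  near0_bigO n (fun s => f s - g s ^+ 2) ->
  near0_bigO n (fun s => Num.sqrt (f s) - g s).
Proof.
move=> c0 e0 hg hf hfg.
have hc s : 0 < s < e -> c <= Num.sqrt (f s) + g s.
  by move=> /hg /le_trans; apply; rewrite lerDr sqrtr_ge0.
apply: (near0_bigO_ext e0 _ (near0_bigOMb hfg (near0_bigO_inv c0 e0 hc))) => s hs.
have gs : Num.sqrt (f s) + g s != 0 by rewrite gt_eqF // (lt_le_trans c0) // hc.
by rewrite -{1}(sqr_sqrtr (hf _ hs)) subr_sqr mulfK.
Qed.

Lemma near0_bigO_horner_sub0 (P : {poly R}) f : near0_bigO 1 f ->
  near0_bigO 1 (fun s => P.[f s] - P`_0).
Proof.
move=> hf; have d : 'X^1 %| P - (P`_0)%:P by rewrite expr1 dvdpX coefB coefC subrr.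
apply: (near0_bigO_ext ltr01 _ (near0_bigO_dvdX hf d)) => s _.
by rewrite hornerD hornerN hornerC.
Qed.

Lemma analytic0_bigO1 f : analytic0 f -> near0_bigO 1 (fun s => f s - f 0).
Proof.
move=> [U [r [K [r0 h hK c]]]].
have h1 : near0_bigO 1 (fun s => f s - (U 0%N).[s]).
  exists ((K + K) / r ^+ 1), r; split=> // s /andP[s0 sr].
  by apply: (adic_limit_dist 0 h r0 hK c); rewrite ltW.
have h2 := near0_bigO_horner_sub0 (U 0%N) near0_bigO_id.
apply: (near0_bigO_ext ltr01 _ (near0_bigOD h1 h2)) => s _.
by rewrite (analytic0_coef0 h r0 c 0) addrA subrK.
Qed.

(** One-sided continuity at 0. It supplies the conditions at s = 0 for inverses and square roots
    from estimates available only for s > 0. *)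
Lemma analytic0_ge f (c e : R) : analytic0 f -> 0 < e ->
  (forall s, 0 < s < e -> c <= f s) -> c <= f 0.
Proof.
move=> /analytic0_bigO1 hO e0 hc; rewrite leNgt; apply/negP => fc.
have [||e' e'0 he'] := @near0_bigO_pos (fun s => c - f s) (c - f 0).
- by rewrite subr_gt0.
- by apply: (near0_bigO_ext ltr01 _ (near0_bigON hO)) => s _; ring.
pose s := Num.min e e' / 2.
have m0 : 0 < Num.min e e' by rewrite lt_min e0.
have s0 : 0 < s by rewrite divr_gt0.
have sm : s < Num.min e e' by rewrite /s; lra.
move: (sm); rewrite lt_min => /andP[se se'].
have := hc s; rewrite s0 se => /(_ isT).
have := he' s; rewrite s0 se' => /(_ isT).
lra.
Qed.

End BigO.

(** * Integrals of exponential polynomials over half-lines and quadrants *)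

Section Integrals.
Variable R : realType.
Notation mu := (@lebesgue_measure R).

(** Nonnegativity is assumed of the whole sum, since the coefficients of p may be negative; so the
    fundamental theorem of calculus is applied to the summed antiderivative instead of term by
    term. *)
Lemma integral_exp_poly n (b : nat -> R) (k : nat -> nat) (a c : R) : 0 < c ->
  (forall y, a <= y -> 0 <= \sum_(j < n) b j * (y ^+ k j * expR (- (c * y)))) ->
  (\int[mu]_(y in `[a, +oo[) (\sum_(j < n) b j * (y ^+ k j * expR (- (c * y))))%:E)%E =
  (\sum_(j < n) b j * emom (k j) a c)%:E.
Proof.
move=> c0 h0.
have cn0 : c != 0 by rewrite gt_eqF.
pose F y := \sum_(j < n) - b j * emom (k j) y c.
have dF (y : R) : is_derive y 1 F (\sum_(j < n) b j * (y ^+ k j * expR (- (c * y)))).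
  apply: is_derive_eq (is_derive_fun_sum _ (fun j : 'I_n =>
    is_derive_funZ (- b j) (is_derive_emom_l (k j) y cn0))) _.
  by apply: eq_bigr => j _; rewrite mulrNN.
have cF (y : R) : {for y, continuous F}.
  by apply: differentiable_continuous; apply/derivable1_diffP; case: (dF y).
rewrite (@ge0_continuous_FTC2y R _ F a 0) //.
- rewrite sub0e /F -EFinN -sumrN; congr (_%:E); apply: eq_bigr => j _.
  by rewrite mulNr opprK.
- apply: continuous_subspaceT => y.
  apply: differentiable_continuous; apply/derivable1_diffP.
  have hE : is_derive y 1 (fun y => expR (- (c * y))) (- c * expR (- (c * y))).
    by under eq_fun do rewrite -mulNr; rewrite -mulNr; exact: is_derive_fun_expR.
  by have [] := is_derive_fun_sum (index_enum 'I_n) (fun j : 'I_n =>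
    is_derive_funZ (b j) (is_derive_funM (is_derive_funXn (k j) y) hE)).
- have -> : 0 = \sum_(j < n) - b j * 0 :> R by rewrite big1 // => j _; rewrite mulr0.
  apply: cvg_big; first exact: add_continuous.
  by move=> j _; apply: cvgM; [exact: cvg_cst | exact: emom_cvg0].
- by apply: cvg_at_right_filter; exact: cF.
- by move=> y _; rewrite derive1E; apply: derive_val.
Qed.

Lemma integral_prod_exp_poly n (q : nat -> R) (k l : nat -> nat) (a b c c' : R) :
  0 < c -> 0 < c' ->
  (forall x y, a <= x -> b <= y -> 0 <= \sum_(j < n) q j * x ^+ k j * y ^+ l j) ->
  (\int[product_measure1 mu mu]_(z in [set z : R * R | (a <= z.1)%R /\ (b <= z.2)%R])
     ((\sum_(j < n) q j * z.1 ^+ k j * z.2 ^+ l j) *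
        (expR (- (c * z.1)) * expR (- (c' * z.2))))%:E)%E =
  (\sum_(j < n) q j * emom (k j) a c * emom (l j) b c')%:E.
Proof.
move=> c0 c'0 h0.
pose f (z : R * R) := (\sum_(j < n) q j * z.1 ^+ k j * z.2 ^+ l j) *
        (expR (- (c * z.1)) * expR (- (c' * z.2))).
pose D : set (R * R) := [set z | a <= z.1 /\ b <= z.2].
rewrite -/D -/(fun z => (f z)%:E).
have f0 z : D z -> 0 <= f z.
  by case: z => x y [/= xa yb]; rewrite !mulr_ge0 ?expR_ge0 // h0.
have fE x y : f (x, y) = \sum_(j < n) (q j * x ^+ k j * expR (- (c * x))) *
     (y ^+ l j * expR (- (c' * y))).
  by rewrite /f /= mulr_suml; apply: eq_bigr => j _; ring.
have mf : measurable_fun setT f.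
  apply: measurable_funM.
    apply: measurable_sum => j; apply: measurable_funM.
      apply: measurable_funM; first exact: measurable_cst.
      by apply: measurable_funX; exact: measurable_fst.
    by apply: measurable_funX; exact: measurable_snd.
  apply: measurable_funM; apply: measurableT_comp => //; apply: measurableT_comp => //;
    apply: measurable_funM => //.
have DE : D = `[a, +oo[%classic `*` `[b, +oo[%classic.
  by apply/seteqP; split => -[x y] /=; rewrite !in_itv /= !andbT.
have mD : measurable D by rewrite DE; apply: measurableX; exact: measurable_itv.
have mfD : measurable_fun setT ((EFin \o f) \_ D).
  apply/(measurable_restrictT _ mD); apply: measurable_funTS.
  exact/measurable_EFinP.
rewrite integral_mkcond fubini_tonelli1; last 2 first.
- exact: mfD.
- by move=> z; rewrite patchE; case: ifPn => // /set_mem /f0; rewrite lee_fin.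
pose G x := \sum_(j < n) q j * emom (l j) b c' * (x ^+ k j * expR (- (c * x))).
have inner x : a <= x ->
    (\int[mu]_(y in `[b, +oo[) (f (x, y))%:E)%E = (G x)%:E.
  move=> ax.
  under eq_integral do rewrite fE.
  rewrite (integral_exp_poly (b := fun j => q j * x ^+ k j * expR (- (c * x)))) //.
    by congr (_%:E); apply: eq_bigr => j _; ring.
  by move=> y yb; rewrite -fE f0.
(* The coefficients of [G] have no definite sign; its nonnegativity comes from its being an integral
   of the nonnegative [f]. *)
have G0 x : a <= x -> 0 <= G x.
  move=> ax; rewrite -lee_fin -inner //; apply: integral_ge0 => y /=.
  by rewrite in_itv /= andbT => yb; rewrite lee_fin f0.
(* The fibre of [D] over x is the half-line from b if a <= x and empty otherwise. *)
transitivity (\int[mu]_x (((fun x => (G x)%:E) \_ `[a, +oo[) x))%E.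
  apply: eq_integral => x _; rewrite /fubini_F patchE; case: ifPn => [/set_mem|/negP nx].
    rewrite /= in_itv /= andbT => ax; rewrite -inner // [RHS]integral_mkcond.
    apply: eq_integral => y _; rewrite !patchE; congr (if _ then _ else _).
    by apply/idP/idP => /set_mem; rewrite DE /= !in_itv /= ?andbT => h; apply/mem_set;
      rewrite /= ?in_itv /= ?andbT //; case: h.
  apply: integral0_eq => y _; rewrite patchE; case: ifPn => // /set_mem [/= ax _].
  by exfalso; apply: nx; apply/mem_set; rewrite /= in_itv /= ax.
rewrite -integral_mkcond (integral_exp_poly (b := fun j => q j * emom (l j) b c')) //.
by congr (_%:E); apply: eq_bigr => j _; ring.
Qed.

End Integrals.

(** * Polynomials with nonnegative roots, inversion of H, and expansions of r and t *)

Section Roots.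
Variables (R : realType) (rs : seq R).
Hypothesis rs_ge0 : all (fun x => 0 <= x) rs.
Let p : {poly R} := \prod_(x <- rs) ('X - x%:P).

Lemma roots_le_largest_root x : x \in rs -> x <= largest_root p.
Proof.
move=> xrs; apply: ub_le_sup; last by rewrite /= root_prod_XsubC.
(* The supremum needs some upper bound of the root set; as the roots are nonnegative, their sum is
   one. *)
exists (\sum_(y <- rs) y) => y /=; rewrite root_prod_XsubC => yrs.
rewrite (big_rem y) //= lerDl big_seq; apply: sumr_ge0 => z /mem_rem zrs.
exact: (allP rs_ge0).
Qed.

Lemma largest_root_ge0 : (0 < size rs)%N -> 0 <= largest_root p.
Proof.
case E : rs => [//|x r] _; have xrs : x \in rs by rewrite E mem_head.
by apply: le_trans (roots_le_largest_root xrs); exact: (allP rs_ge0).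
Qed.

Lemma horner_prod_XsubC_ge0 u : largest_root p <= u -> 0 <= p.[u].
Proof.
move=> hu; rewrite horner_prod big_seq; apply: prodr_ge0 => x xrs.
by rewrite hornerXsubC subr_ge0 (le_trans (roots_le_largest_root xrs)).
Qed.

Lemma logderiv_prod_XsubC (u : R) (r : seq R) : (forall x, x \in r -> u != x) ->
  (\prod_(x <- r) ('X - x%:P))^`().[u] / (\prod_(x <- r) ('X - x%:P)).[u] =
  \sum_(x <- r) (u - x)^-1.
Proof.
elim: r => [|x r IH] h; first by rewrite !big_nil -polyC1 derivC horner0 mul0r.
rewrite !big_cons derivM derivXsubC mul1r hornerD !hornerM hornerXsubC.
set P := \prod_(x <- r) _ in IH *.
have ux : u - x != 0 by rewrite subr_eq0 h // mem_head.
have Pu : P.[u] != 0.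
  rewrite -/(root P u) root_prod_XsubC; apply/negP => ur.
  by have := h u; rewrite inE ur orbT eqxx => /(_ isT).
rewrite -IH; first by field; rewrite ?ux ?Pu.
by move=> y yr; apply: h; rewrite inE yr orbT.
Qed.

Lemma sqrt_largest_root_lt x z : (0 < size rs)%N -> Num.sqrt (largest_root p) < z ->
  x \in rs -> x < z ^+ 2.
Proof.
move=> rs0 hz xrs; apply: le_lt_trans (roots_le_largest_root xrs) _.
rewrite -(sqr_sqrtr (largest_root_ge0 rs0)).
by apply: ltrXn2r => //; rewrite ?nnegrE ?sqrtr_ge0 // (le_trans (sqrtr_ge0 _) (ltW hz)).
Qed.

Lemma logderiv_roots z : (0 < size rs)%N -> Num.sqrt (largest_root p) < z ->
  z * p^`().[z ^+ 2] / p.[z ^+ 2] = \sum_(x <- rs) z / (z ^+ 2 - x).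
Proof.
move=> rs0 hz; rewrite -mulrA logderiv_prod_XsubC ?mulr_sumr // => x xrs.
by rewrite gt_eqF // sqrt_largest_root_lt.
Qed.

Lemma logderiv_roots_gt0 z : (0 < size rs)%N -> Num.sqrt (largest_root p) < z ->
  0 < z * p^`().[z ^+ 2] / p.[z ^+ 2].
Proof.
move=> rs0 hz; rewrite logderiv_roots //.
have z0 : 0 < z by apply: le_lt_trans hz; exact: sqrtr_ge0.
case E : rs => [|x r]; first by move: rs0; rewrite E.
have pos y : y \in rs -> 0 < z / (z ^+ 2 - y).
  by move=> yrs; rewrite divr_gt0 // subr_gt0 sqrt_largest_root_lt.
rewrite big_cons; apply: ltr_wpDr; last by apply: pos; rewrite E mem_head.
by rewrite big_seq; apply: sumr_ge0 => y yr; apply/ltW/pos; rewrite E inE yr orbT.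
Qed.

Lemma logderiv_roots_decr z1 z2 : (0 < size rs)%N -> Num.sqrt (largest_root p) < z1 ->
  z1 < z2 ->
  z2 * p^`().[z2 ^+ 2] / p.[z2 ^+ 2] < z1 * p^`().[z1 ^+ 2] / p.[z1 ^+ 2].
Proof.
move=> rs0 hz1 z12; have hz2 := lt_trans hz1 z12; rewrite !logderiv_roots //.
have z10 : 0 < z1 by apply: le_lt_trans hz1; exact: sqrtr_ge0.
have z20 : 0 < z2 := lt_trans z10 z12.
(* After clearing the positive denominators the difference is (z2 - z1)(z1 z2 + y). *)
have dec y : y \in rs -> z2 / (z2 ^+ 2 - y) < z1 / (z1 ^+ 2 - y).
  move=> yrs; have y0 : 0 <= y by exact: (allP rs_ge0).
  have h1 : 0 < z1 ^+ 2 - y by rewrite subr_gt0 sqrt_largest_root_lt.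
  have h2 : 0 < z2 ^+ 2 - y by rewrite subr_gt0 sqrt_largest_root_lt.
  rewrite ltr_pdivrMr // mulrAC ltr_pdivlMr //.
  have h3 : 0 < (z2 - z1) * (z1 * z2) by rewrite !mulr_gt0 // subr_gt0.
  have h4 : 0 <= (z2 - z1) * y by rewrite mulr_ge0 // subr_ge0 ltW.
  by rewrite -subr_gt0 (_ : _ - _ = (z2 - z1) * (z1 * z2) + (z2 - z1) * y) ?ltr_wpDr //; ring.
case E : rs => [|x r]; first by move: rs0; rewrite E.
rewrite !big_cons; apply: ltr_leD; first by apply: dec; rewrite E mem_head.
by rewrite !big_seq; apply: ler_sum => y yr; apply/ltW/dec; rewrite E inE yr orbT.
Qed.

Variables (m d : nat).
Hypotheses (d_gt0 : (0 < d)%N) (d_le_m : (d <= m)%N) (size_rs : size rs = d).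

Let dR0 : 0 < d%:R :> R. Proof. by rewrite ltr0n. Qed.
Let mR0 : 0 < m%:R :> R. Proof. by rewrite ltr0n (leq_trans d_gt0). Qed.
Let dm : d%:R <= m%:R :> R. Proof. by rewrite ler_nat. Qed.
Let rs0 : (0 < size rs)%N. Proof. by rewrite size_rs. Qed.

Lemma lam_gt0 : 0 < lam R m d.
Proof. by rewrite /lam divr_gt0. Qed.

Lemma lam_le1 : lam R m d <= 1.
Proof. by rewrite /lam ler_pdivrMr // mul1r. Qed.

Lemma Hf_decr z1 z2 : Num.sqrt (largest_root p) < z1 -> z1 < z2 ->
  Hf m d p z2 < Hf m d p z1.
Proof.
move=> hz1 z12; have hz2 := lt_trans hz1 z12.
have z10 : 0 < z1 by apply: le_lt_trans hz1; exact: sqrtr_ge0.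
have z20 : 0 < z2 := lt_trans z10 z12.
have G2 : 0 < Gf d p z2 by rewrite mulr_gt0 ?invr_gt0 // logderiv_roots_gt0.
have G12 : Gf d p z2 < Gf d p z1.
  by rewrite ltr_pM2l ?invr_gt0 //; exact: logderiv_roots_decr.
have l0 := lam_gt0; have l1 := lam_le1.
rewrite /Hf; apply: ltr_pM => //; first exact: ltW.
  by apply: addr_ge0; [apply: mulr_ge0 | apply: divr_ge0]; rewrite ?subr_ge0 // ltW.
apply: ltr_leD; first by rewrite ltr_pM2l.
by apply: ler_wpM2l; rewrite ?subr_ge0 // lef_pV2 ?posrE // ltW.
Qed.

(** Strict monotonicity makes the preimage unique, so exhibiting one determines the value chosen by
    [xget]. *)
Lemma Jf_eq u z : Num.sqrt (largest_root p) < z -> Hf m d p z = u -> Jf m d p u = z.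
Proof.
move=> hz Hz; apply: xget_unique => // y [hy Hy].
have [yz|zy|//] := ltgtP y z.
  by have := Hf_decr hy yz; rewrite Hy Hz ltxx.
by have := Hf_decr hz zy; rewrite Hy Hz ltxx.
Qed.

(** [rev_p] is u^d p(1/u), moving the point z = infinity to u = 1/z^2 = 0; [rev_q]/(d [rev_p]) is
    then z G(z). *)
Let rev_p : {poly R} := \prod_(x <- rs) (1 - x *: 'X).
Let rev_q : {poly R} := d%:R *: rev_p - 'X * rev_p^`().

(** Each 1/(1 - xu) equals 1 + xu/(1 - xu), and the second terms add up to -u P'(u)/P(u). *)
Lemma rev_logderiv (u : R) (r : seq R) : (forall x, x \in r -> 1 - x * u != 0) ->
  (\prod_(x <- r) (1 - x *: 'X)).[u] != 0 /\
  ((size r)%:R *: \prod_(x <- r) (1 - x *: 'X) -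
     'X * (\prod_(x <- r) (1 - x *: 'X))^`()).[u] / (\prod_(x <- r) (1 - x *: 'X)).[u]
   = \sum_(x <- r) (1 - x * u)^-1.
Proof.
elim: r => [|x r IH] h.
  rewrite !big_nil -polyC1 derivC scale0r mulr0 subr0 horner0 mul0r hornerC.
  by split=> //; exact: oner_neq0.
have [|P0 E] := IH; first by move=> y yr; apply: h; rewrite inE yr orbT.
have hx : 1 - x * u != 0 by rewrite h // mem_head.
rewrite !big_cons; move: P0 E; set P := \prod_(x <- r) _ => P0 E.
have hE : (1 - x *: 'X : {poly R}).[u] = 1 - x * u.
  by rewrite hornerD hornerN hornerZ hornerX -polyC1 hornerC.
split; first by rewrite hornerM hE mulf_neq0.
rewrite -E /= -natr1 !(hornerD, hornerN, hornerM, hornerZ, hornerX, derivM, derivB, derivZ, derivX).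
rewrite -polyC1 derivC hornerC horner0; field.
by rewrite ?hx ?P0.
Qed.

Lemma rf_tf_analytic : exists rho tau (e : R), [/\ analytic0 rho, analytic0 tau, 0 < e &
  forall s, 0 < s < e -> [/\ rf m d p s = s * rho s, tf m d p s = s * tau s,
    0 < rf m d p s, 0 < tf m d p s & rf m d p s * tf m d p s = s ^+ 2]].
Proof.
pose l := lam R m d; have l0 := lam_gt0; have l1 := lam_le1; rewrite -/l in l0 l1.
have [P EP] : exists P, P = rev_p by exists rev_p.
have [Q EQ] : exists Q, Q = rev_q by exists rev_q.
have p0 : P`_0 = 1.
  rewrite EP -horner_coef0 horner_prod big1 // => x _.
  by rewrite hornerD hornerN hornerZ hornerX -polyC1 hornerC mulr0 subr0.
have q0 : Q`_0 = d%:R by rewrite EQ coefB coefZ -EP p0 coefXM subr0 mulr1.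
(* With w = 1/z, w^2 = s^2 y and gamma = z G(z), the equation H(z) = s^2 reads y gamma (lambda gamma
   + 1 - lambda) = 1. Substituting gamma = Q/(dP) and multiplying by P^2 makes it polynomial. *)
have [||y [e1 [ay e10 y0 hy]]] :=
    @analytic0_implicit R (d%:R^-1 *: Q * (l *: (d%:R^-1 *: Q) + (1 - l) *: P))
    (P ^+ 2).
- rewrite -horner_coef0 !(hornerM, hornerD, hornerZ) !horner_coef0 p0 q0.
  by rewrite mulVf ?gt_eqF //; ring.
- by rewrite -horner_coef0 horner_exp horner_coef0 p0 expr1n.
pose gam s := d%:R^-1 * \sum_(x <- rs) (1 - x * (s ^+ 2 * y s))^-1.
pose th s := Num.sqrt (y s).
have as2y : analytic0 (fun s => s ^+ 2 * y s).
  by apply: analytic0M => //; apply: analytic0X; exact: analytic0_id.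
have agam : analytic0 gam.
  apply: analytic0Z; apply: analytic0_sum => x; apply: analytic0V.
    apply: (analytic0_ext ltr01 _ (analytic0D (analytic0_cst 1) (analytic0Z (- x) as2y))).
    by move=> s _; rewrite mulNr.
  by rewrite expr0n mul0r mulr0 subr0 oner_neq0.
have ath : analytic0 th by apply: analytic0_sqrt => //; rewrite y0.
pose N := smd R m d.
have N0 : 0 < N by rewrite sqrtr_gt0 mulr_gt0.
have N2 : N ^+ 2 = m%:R * d%:R by rewrite sqr_sqrtr // mulr_ge0 // ltW.
exists (fun s => N^-1 * d%:R * (th s * gam s)),
  (fun s => N^-1 * (th s * (d%:R * gam s + (m%:R - d%:R)))).
have [|e2 e20 he2] := @near0_bigO_pos _ y 1 ltr01.
  by have := analytic0_bigO1 ay; rewrite y0.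
(* This keeps [largest_root p] times w^2 below 1, so that 1/w lies in the domain of H. *)
have [|e3 e30 he3] := @near0_bigO_pos _ (fun s => 1 - largest_root p * (s ^+ 2 * y s)) 1 ltr01.
  have := near0_bigOZ (- largest_root p) (analytic0_bigO1 as2y).
  by apply: (near0_bigO_ext ltr01) => s _; rewrite expr0n mul0r; ring.
exists (Num.min e1 (Num.min e2 e3)); split.
- by apply: analytic0Z; exact: analytic0M.
- apply: analytic0Z; apply: analytic0M => //; apply: analytic0D; last exact: analytic0_cst.
  exact: analytic0Z.
- by rewrite !lt_min e10 e20.
move=> s; rewrite !lt_min => /and4P[s0 se1 se2 se3].
have {}hy := hy s; rewrite (ltW s0) se1 in hy; have {}hy := hy isT.
have {}he2 := he2 s; rewrite s0 se2 in he2; have {}he2 := he2 isT.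
have {}he3 := he3 s; rewrite s0 se3 in he3; have {}he3 := he3 isT.
have ys0 : 0 < y s by lra.
pose w := s * th s.
have th0 : 0 < th s by rewrite sqrtr_gt0.
have w0 : 0 < w by rewrite mulr_gt0.
have w2 : w ^+ 2 = s ^+ 2 * y s by rewrite exprMn sqr_sqrtr // ltW.
rewrite -w2 in hy he3.
have L0 := largest_root_ge0 rs0.
have hz : Num.sqrt (largest_root p) < w^-1.
  have h : (Num.sqrt (largest_root p) * w) ^+ 2 < 1 by rewrite exprMn sqr_sqrtr //; lra.
  rewrite -(ltr_pM2r w0) mulVf; last by rewrite gt_eqF.
  by rewrite ltNge; apply/negP => /(exprn_ege1 2); rewrite leNgt h.
have w_neq0 : w != 0 by rewrite gt_eqF.
have nz x : x \in rs -> 1 - x * w ^+ 2 != 0.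
  move=> xrs; rewrite gt_eqF //.
  have : x * w ^+ 2 <= largest_root p * w ^+ 2.
    by rewrite ler_wpM2r ?sqr_ge0 // roots_le_largest_root.
  lra.
have Elog : w^-1 * p^`().[w^-1 ^+ 2] / p.[w^-1 ^+ 2] = w * (d%:R * gam s).
  have -> : d%:R * gam s = \sum_(x <- rs) (1 - x * w ^+ 2)^-1.
    by rewrite w2 /gam mulVKf ?gt_eqF.
  rewrite logderiv_roots // mulr_sumr big_seq [RHS]big_seq.
  apply: eq_bigr => x /nz nx.
  have nx' : w^-1 ^+ 2 - x != 0.
    have -> : w^-1 ^+ 2 - x = (1 - x * w ^+ 2) / w ^+ 2 by field.
    by rewrite mulf_neq0 // invr_eq0 expf_neq0.
  by field; rewrite w_neq0 nx.
have EG : Gf d p w^-1 = w * gam s.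
  by rewrite /Gf Elog; field; rewrite gt_eqF.
have gam0 : 0 < gam s.
  have : 0 < Gf d p w^-1 by rewrite mulr_gt0 ?invr_gt0 // logderiv_roots_gt0.
  by rewrite EG pmulr_rgt0.
have [] := rev_logderiv nz; rewrite -/rev_p -EP => pw Ew.
have gE : gam s = d%:R^-1 * (Q.[w ^+ 2] / P.[w ^+ 2]).
  by rewrite /gam EQ /rev_q -EP -w2 -Ew size_rs.
have yh : y s * (gam s * (l * gam s + (1 - l))) = 1.
  move: hy; rewrite horner_exp !(hornerM, hornerD, hornerZ) => hy.
  apply: (mulIf (expf_neq0 2 pw)); rewrite mul1r -[RHS]hy gE.
  by field; rewrite pw gt_eqF.
(* So 1/w is the preimage of s^2, and [zf] can be evaluated. *)
have EH : Hf m d p w^-1 = s ^+ 2.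
  rewrite /Hf EG -/l invrK.
  have -> : w * gam s * (l * (w * gam s) + (1 - l) * w) =
     w ^+ 2 * (gam s * (l * gam s + (1 - l))) by ring.
  by rewrite w2 -mulrA yh mulr1.
have Ez : zf m d p s = w^-1 by rewrite /zf; exact: Jf_eq.
have Er : rf m d p s = N^-1 * (w * (d%:R * gam s)) by rewrite /rf Ez Elog.
have Et : tf m d p s = N^-1 * (w * (d%:R * gam s + (m%:R - d%:R))).
  by rewrite /tf Er Ez -/N; field; rewrite w_neq0 gt_eqF.
split.
- by rewrite Er /w; ring.
- by rewrite Et /w; ring.
- by rewrite Er; do !apply: mulr_gt0 => //; rewrite invr_gt0.
- by rewrite Et; do !apply: mulr_gt0 => //; rewrite ?invr_gt0 // ltr_wpDr ?subr_ge0 // mulr_gt0.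
rewrite Er Et.
(* As N^2 = md and lambda = d/m, the product r t is H(1/w) rewritten. *)
have -> : N^-1 * (w * (d%:R * gam s)) * (N^-1 * (w * (d%:R * gam s + (m%:R - d%:R)))) =
   (N ^+ 2)^-1 * (w ^+ 2 * d%:R * (gam s * (d%:R * gam s + (m%:R - d%:R)))).
  by field; rewrite gt_eqF.
rewrite N2 w2; move: yh; rewrite /l /lam => yh.
have -> : s ^+ 2 * y s * d%:R * (gam s * (d%:R * gam s + (m%:R - d%:R))) =
  s ^+ 2 * (m%:R * d%:R) * (y s * (gam s * (d%:R / m%:R * gam s + (1 - d%:R / m%:R)))).
  by field; rewrite gt_eqF.
rewrite yh; field.
by rewrite !gt_eqF.
Qed.

End Roots.

(** * The norm of the exponentially tilted Delta *)

Section Norm.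
Variables (R : realType) (rs : seq R) (m d : nat).
Hypothesis rs_ge0 : all (fun x => 0 <= x) rs.
Hypotheses (d_gt0 : (0 < d)%N) (d_le_m : (d <= m)%N) (size_rs : size rs = d).
Let p : {poly R} := \prod_(x <- rs) ('X - x%:P).
Let a := Num.sqrt (largest_root p).
Let N := smd R m d.

Lemma smd_gt0 : 0 < N.
Proof. by rewrite sqrtr_gt0 mulr_gt0 // ltr0n // (leq_trans d_gt0). Qed.

Lemma smd_sqr : N ^+ 2 = m%:R * d%:R.
Proof. by rewrite sqr_sqrtr // mulr_ge0. Qed.

Lemma size_roots_poly : size p = d.+1.
Proof. by rewrite size_prod_XsubC size_rs. Qed.

(** The indices [i] and [k] insert extra factors x^i and y^k, which record derivatives in c and c'
    up to sign. *)
Definition tilted_moment (i k : nat) (c c' : R) :=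
  \sum_(j < d.+1) p`_j * emom (j + i) a c * emom ((m - d) + j + k) a c'.

(** The power N turns the real exponents of [Delta] into the integers m - d and 1. The rules for
    real powers need p(xy) >= 0, true because xy is at least a^2, the largest root. *)
Lemma Delta_tilted_powR (x y r t : R) : a <= x -> a <= y ->
  (expR (- x * r - y * t) * Delta m d p (x, y)) `^ N =
  (\sum_(j < d.+1) p`_j * x ^+ (j + 0) * y ^+ ((m - d) + j + 0)) *
    (expR (- ((N * r) * x)) * expR (- ((N * t) * y))).
Proof.
move=> ax ay; have a0 : 0 <= a by exact: sqrtr_ge0.
have x0 := le_trans a0 ax; have y0 := le_trans a0 ay.
have N0 := smd_gt0; have Nn0 : N != 0 by rewrite gt_eqF.
have pxy : 0 <= p.[x * y].
  apply: horner_prod_XsubC_ge0 => //.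
  rewrite -(@sqr_sqrtr _ (largest_root p)); last first.
    by apply: largest_root_ge0 => //; rewrite size_rs.
  by rewrite expr2; apply: ler_pM.
rewrite /Delta /= -/N !powRM ?mulr_ge0 ?powR_ge0 ?expR_ge0 //.
rewrite -expRM -!powRrM mulfVK // mulVf // powRr1 // -natrB // powR_mulrn //.
rewrite mulrC; congr (_ * _).
  rewrite horner_coef size_roots_poly mulr_sumr; apply: eq_bigr => j _.
  by rewrite !addn0 exprMn exprD; ring.
by rewrite -expRD; congr expR; ring.
Qed.

Lemma normq_tilted_moment (r t : R) : 0 < r -> 0 < t ->
  Defs.normq m d p r t = tilted_moment 0 0 (N * r) (N * t) `^ N^-1.
Proof.
move=> r0 t0; have N0 := smd_gt0.
rewrite /Defs.normq -/N; congr (_ `^ _).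
(* At r = t = 0 the previous identity exhibits this polynomial as a real power. *)
have nonneg x y : a <= x -> a <= y ->
    0 <= \sum_(j < d.+1) p`_j * x ^+ (j + 0) * y ^+ ((m - d) + j + 0).
  move=> ax ay; have := Delta_tilted_powR 0 0 ax ay.
  by rewrite !mulr0 !mul0r oppr0 expR0 !mulr1 => <-; exact: powR_ge0.
have E := integral_prod_exp_poly (q := fun j => p`_j) (k := fun j => (j + 0)%N)
  (l := fun j => (m - d + j + 0)%N) (mulr_gt0 N0 r0) (mulr_gt0 N0 t0) nonneg.
rewrite -[RHS]/(fine (tilted_moment 0 0 (N * r) (N * t))%:E) -E; congr fine.
apply: eq_integral => -[x y] /set_mem [/= ax ay].
by rewrite Delta_tilted_powR.
Qed.

Lemma is_derive_tilted_moment_l (i k : nat) (c c' : R) : c != 0 ->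
  is_derive c 1 (fun c => tilted_moment i k c c') (- tilted_moment i.+1 k c c').
Proof.
move=> c0; rewrite /tilted_moment -sumrN.
apply: is_derive_fun_sum => j.
have -> : (fun c => p`_j * emom (j + i) a c * emom (m - d + j + k) a c') =
  (fun c => (p`_j * emom (m - d + j + k) a c') * emom (j + i) a c).
  by apply/funext => x; ring.
apply: is_derive_eq (is_derive_funZ _ (is_derive_emom_r _ _ c0)) _.
by rewrite -addnS; ring.
Qed.

Lemma is_derive_tilted_moment_r (i k : nat) (c c' : R) : c' != 0 ->
  is_derive c' 1 (fun c' => tilted_moment i k c c') (- tilted_moment i k.+1 c c').
Proof.
move=> c0; rewrite /tilted_moment -sumrN.
apply: is_derive_fun_sum => j.
apply: is_derive_eq (is_derive_funZ _ (is_derive_emom_r _ _ c0)) _.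
by rewrite -addnS; ring.
Qed.

(** The factor 1/N from the N-th root cancels the N of the chain rule. The closed form of the norm
    is available only for positive parameters, so the two functions are compared near r. *)
Lemma derive1_ln_normq_l (r t : R) : 0 < r -> 0 < t ->
  0 < tilted_moment 0 0 (N * r) (N * t) ->
  derive1 (fun r => ln (Defs.normq m d p r t)) r =
    - (tilted_moment 1 0 (N * r) (N * t) / tilted_moment 0 0 (N * r) (N * t)).
Proof.
move=> r0 t0 I0; have N0 := smd_gt0.
rewrite derive1E.
rewrite (@near_eq_derive _ _ _ _ (fun r => N^-1 * ln (tilted_moment 0 0 (N * r) (N * t)))).
  have Nr : N * r != 0 by rewrite gt_eqF // mulr_gt0.
  have h := is_derive1_comp (is_derive_tilted_moment_l 0 0 (N * t) Nr)
     (is_derive_funZ N (is_derive_id r 1)).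
  rewrite (derive_val (is_derive := is_derive_funZ N^-1
    (@is_derive_fun_ln _ (fun r => tilted_moment 0 0 (N * r) (N * t)) _ _ I0 h))).
  by field; rewrite !gt_eqF.
near=> x.
have x0 : 0 < x by near: x; exact: lt_nbhsr.
by rewrite normq_tilted_moment // ln_powR.
Unshelve. all: by end_near. Qed.

Lemma derive1_ln_normq_r (r t : R) : 0 < r -> 0 < t ->
  0 < tilted_moment 0 0 (N * r) (N * t) ->
  derive1 (fun t => ln (Defs.normq m d p r t)) t =
    - (tilted_moment 0 1 (N * r) (N * t) / tilted_moment 0 0 (N * r) (N * t)).
Proof.
move=> r0 t0 I0; have N0 := smd_gt0.
rewrite derive1E.
rewrite (@near_eq_derive _ _ _ _ (fun t => N^-1 * ln (tilted_moment 0 0 (N * r) (N * t)))).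
  have Nt : N * t != 0 by rewrite gt_eqF // mulr_gt0.
  have h := is_derive1_comp (is_derive_tilted_moment_r 0 0 (N * r) Nt)
     (is_derive_funZ N (is_derive_id t 1)).
  rewrite (derive_val (is_derive := is_derive_funZ N^-1
    (@is_derive_fun_ln _ (fun t => tilted_moment 0 0 (N * r) (N * t)) _ _ I0 h))).
  by field; rewrite !gt_eqF.
near=> x.
have x0 : 0 < x by near: x; exact: lt_nbhsr.
by rewrite normq_tilted_moment // ln_powR.
Unshelve. all: by end_near. Qed.

(* [tilted_moment] multiplied by [c ^ (d+1+i) c' ^ (m+1+k)] and by
   [exp (a (c + c'))]: all negative powers and exponentials disappear. *)
Definition scaled_moment (i k : nat) (c c' : R) :=
  \sum_(j < d.+1) p`_j * (c * c') ^+ (d - j) *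
    ((incexp R (j + i)).[c * a] * (incexp R ((m - d) + j + k)).[c' * a]).

Lemma tilted_moment_scaled (i k : nat) (c c' : R) : c != 0 -> c' != 0 ->
  c ^+ (d.+1 + i) * c' ^+ (m.+1 + k) * tilted_moment i k c c' =
  expR (- (c * a)) * expR (- (c' * a)) * scaled_moment i k c c'.
Proof.
move=> c0 c'0; rewrite !mulr_sumr; apply: eq_bigr => j _.
have jd : (j <= d)%N by rewrite -ltnS.
(* In the j-th term, c^(j+i+1) clears the moment in c, and the leftover c^(d-j) pairs with the same
   power of c'; outside [incexp] only the product c c' remains. *)
have -> : (d.+1 + i = (d - j) + (j + i).+1)%N by lia.
have -> : (m.+1 + k = (d - j) + (m - d + j + k).+1)%N by lia.
rewrite !exprD exprMn.
have := emom_incexp (j + i) a c0; have := emom_incexp (m - d + j + k) a c'0.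
move: (c ^+ _.+1) (c' ^+ _.+1) => x y E1 E2.
transitivity (p`_j * (c ^+ (d - j) * c' ^+ (d - j)) * ((x * emom (j + i) a c) * (y * emom (m - d + j + k) a c'))).
  by ring.
by rewrite E1 E2; ring.
Qed.

End Norm.

(** * Comparison with the finite R-transform *)

Section Comparison.
Variable R : realType.

Lemma near0_bigO_dom n (f g : R -> R) (e : R) : 0 < e ->
  (forall s, 0 < s < e -> `|f s| <= `|g s|) -> near0_bigO n g -> near0_bigO n f.
Proof.
move=> e0 fg [C [e' [e'0 h]]]; exists C, (Num.min e e'); rewrite lt_min e0 e'0; split=> // s.
rewrite lt_min => /and3P[s0 se se']; apply: le_trans (fg _ _) (h _ _); by rewrite s0.
Qed.

Lemma near0_bigO_expN_incexp k (a e : R) (c : R -> R) : 0 <= a -> 0 < e ->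
  (forall s, 0 < s < e -> 0 <= c s) -> near0_bigO 1 c ->
  near0_bigO k.+1 (fun s => expR (- (c s * a)) * (incexp R k).[c s * a] - k`!%:R).
Proof.
move=> a0 e0 c0 hc.
have h : near0_bigO (1 * k.+1) (fun s => (c s * a) ^+ k.+1).
  by apply: near0_bigOX; apply: near0_bigOMb => //; exact: near0_bigO_cst.
rewrite mul1n in h; apply: (near0_bigO_dom e0 _ h) => s hs.
by apply: le_trans (expN_incexp_dist _ _) (ler_norm _); rewrite mulr_ge0 // c0.
Qed.

Variables (m d : nat) (p : {poly R}).
Hypotheses (d_gt0 : (0 < d)%N) (d_le_m : (d <= m)%N).
Hypotheses (p_monic : p \is monic) (size_p : size p = d.+1).
Let E := Ep m d p.

(** The sign in [Ep] cancels the one in [pcoef], leaving plain coefficients of p. *)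
Lemma coef_Ep i : (i <= d)%N -> (m`! * d`!)%:R * E`_i =
  (m%:R * d%:R) ^+ i * p`_(d - i) * ((m - i)`! * (d - i)`!)%:R.
Proof.
move=> id; rewrite coef_poly ltnS id /pcoef.
have f0 : (m`! * d`!)%:R != 0 :> R by rewrite pnatr_eq0 -lt0n muln_gt0 !fact_gt0.
have sgn : (-1) ^+ i * (-1) ^+ i = 1 :> R by rewrite -expr2 sqrr_sign.
transitivity ((-1) ^+ i * (-1) ^+ i * ((m%:R * d%:R) ^+ i * p`_(d - i) * ((m - i)`! * (d - i)`!)%:R)).
  move: ((m`! * d`!)%:R) f0 => f f0; move: ((-1) ^+ i) (((m - i)`! * _)%:R) => x g.
  by field.
by rewrite sgn mul1r.
Qed.

Lemma Ep_0 : E`_0 = 1.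
Proof.
have f0 : (m`! * d`!)%:R != 0 :> R by rewrite pnatr_eq0 -lt0n muln_gt0 !fact_gt0.
apply: (mulfI f0); rewrite coef_Ep // !subn0 expr0 mul1r mulr1.
have : p`_d = 1 by have := monicP p_monic; rewrite lead_coefE size_p.
by move=> ->; rewrite mul1r.
Qed.

(** A factor al + be i on the coefficient of u^i is the action of al + be u d/du, here with i = d -
    j. The shifted factorials fit this form: (j+1)! = j! (d+1 - i), and (m-d+j+1)! is (m-d+j)! times
    m+1 - i. *)
Lemma horner_Ep_comb (al be u : R) :
  \sum_(j < d.+1) p`_j * ((m%:R * d%:R) * u) ^+ (d - j) *
     ((j`! * (m - d + j)`!)%:R * (al + be * (d - j)%:R)) =
  (m`! * d`!)%:R * (al *: E + be *: ('X * E^`())).[u].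
Proof.
have co i : (al *: E + be *: ('X * E^`()))`_i = (al + be * i%:R) * E`_i.
  rewrite coefD !coefZ coefXM coef_deriv; case: i => [|i] /=; first by ring.
  by rewrite -mulr_natr; ring.
have sz : (size (al *: E + be *: ('X * E^`()))%R <= d.+1)%N.
  apply/leq_sizeP => i hi; rewrite co nth_default ?mulr0 //.
  by apply: leq_trans hi; exact: size_poly.
rewrite (horner_coef_wide _ sz) mulr_sumr (reindex_inj rev_ord_inj) /=.
apply: eq_bigr => i _; have id : (i <= d)%N by rewrite -ltnS.
rewrite subSS co subKn //.
rewrite (_ : m - d + (d - i) = m - i)%N; last by lia.
rewrite exprMn [(_ `! * _)%N]mulnC.
transitivity (((m%:R * d%:R) ^+ i * p`_(d - i) * ((m - i)`! * (d - i)`!)%:R) * ((al + be * i%:R) * u ^+ i)).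
  by ring.
by rewrite -coef_Ep //; ring.
Qed.

Lemma horner_Ep_00 (u : R) :
  \sum_(j < d.+1) p`_j * ((m%:R * d%:R) * u) ^+ (d - j) *
     ((j + 0)`!%:R * (m - d + j + 0)`!%:R) = (m`! * d`!)%:R * E.[u].
Proof.
have := horner_Ep_comb 1 0 u; rewrite scale1r scale0r addr0 => <-.
by apply: eq_bigr => j _; rewrite !addn0 natrM mul0r addr0 mulr1.
Qed.

Lemma horner_Ep_10 (u : R) :
  \sum_(j < d.+1) p`_j * ((m%:R * d%:R) * u) ^+ (d - j) *
     ((j + 1)`!%:R * (m - d + j + 0)`!%:R) =
  (m`! * d`!)%:R * (d.+1%:R *: E - 'X * E^`()).[u].
Proof.
have := horner_Ep_comb d.+1%:R (-1) u; rewrite scaleN1r => <-.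
apply: eq_bigr => j _; have jd : (j <= d)%N by rewrite -ltnS.
by rewrite addn0 addn1 factS !natrM mulN1r -natrB ?leqW ?leq_subr // subSn ?leq_subr // subKn //; ring.
Qed.

Lemma horner_Ep_01 (u : R) :
  \sum_(j < d.+1) p`_j * ((m%:R * d%:R) * u) ^+ (d - j) *
     ((j + 0)`!%:R * (m - d + j + 1)`!%:R) =
  (m`! * d`!)%:R * (m.+1%:R *: E - 'X * E^`()).[u].
Proof.
have := horner_Ep_comb m.+1%:R (-1) u; rewrite scaleN1r => <-.
apply: eq_bigr => j _; have jd : (j <= d)%N by rewrite -ltnS.
rewrite addn0 addn1 factS !natrM mulN1r -natrB; last by lia.
rewrite (_ : m.+1 - (d - j) = (m - d + j).+1)%N; last by lia.
by ring.
Qed.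

End Comparison.

(** * Expansion of the moment ratios and of R-tilde *)

Section Asymptotics.
Variables (R : realType) (rs : seq R) (m d : nat).
Hypothesis rs_ge0 : all (fun x => 0 <= x) rs.
Hypotheses (d_gt0 : (0 < d)%N) (d_le_m : (d <= m)%N) (size_rs : size rs = d).
Let p : {poly R} := \prod_(x <- rs) ('X - x%:P).
Let a := Num.sqrt (largest_root p).
Let N := smd R m d.
Let E := Ep m d p.
Let size_p : size p = d.+1. Proof. exact: size_roots_poly. Qed.
Let p_monic : p \is monic. Proof. exact: monic_prod_XsubC. Qed.

(** The j-th term carries (c c')^(d-j), of order s^(2(d-j)), and its two incomplete exponentials
    differ from factorials by O(s^(j+1)). The total order 2d - j + 1 is at least d + 1, with
    equality at j = d: this fixes the precision of the theorem. *)
Lemma scaled_moment_asymp i k (c c' : R -> R) (e : R) : 0 < e ->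
  near0_bigO 1 c -> near0_bigO 1 c' ->
  (forall s, 0 < s < e -> [/\ 0 < c s, 0 < c' s & c s * c' s = m%:R * d%:R * s ^+ 2]) ->
  near0_bigO d.+1 (fun s =>
    expR (- (c s * a)) * expR (- (c' s * a)) * scaled_moment rs m d i k (c s) (c' s) -
    \sum_(j < d.+1) p`_j * (m%:R * d%:R * s ^+ 2) ^+ (d - j) *
      ((j + i)`!%:R * (m - d + j + k)`!%:R)).
Proof.
move=> e0 hc hc' hcc.
have a0 : 0 <= a by exact: sqrtr_ge0.
have c0 s : 0 < s < e -> 0 <= c s by move=> /hcc[/ltW].
have c'0 s : 0 < s < e -> 0 <= c' s by move=> /hcc[_ /ltW].
pose x n s := expR (- (c s * a)) * (incexp R n).[c s * a].
pose y n s := expR (- (c' s * a)) * (incexp R n).[c' s * a].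
have hx n : near0_bigO n.+1 (fun s => x n s - n`!%:R) by exact: near0_bigO_expN_incexp a0 e0 c0 hc.
have hy n : near0_bigO n.+1 (fun s => y n s - n`!%:R) by exact: near0_bigO_expN_incexp a0 e0 c'0 hc'.
have y0 n : near0_bigO 0 (y n).
  apply: (near0_bigO_ext ltr01 _ (near0_bigOD (near0_bigO_le (leq0n _) (hy n))
    (near0_bigO_cst n`!%:R))) => s _.
  by rewrite subrK.
have term (j : 'I_d.+1) : near0_bigO d.+1 (fun s => p`_j * (m%:R * d%:R * s ^+ 2) ^+ (d - j) *
   ((x (j + i)%N s - (j + i)`!%:R) * y (m - d + j + k)%N s +
     (j + i)`!%:R * (y (m - d + j + k)%N s - (m - d + j + k)`!%:R))).
  have jd : (j <= d)%N by rewrite -ltnS.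
  have h1 : near0_bigO (2 * (d - j)) (fun s : R => p`_j * (m%:R * d%:R * s ^+ 2) ^+ (d - j)).
    apply: near0_bigOZ; apply: near0_bigOX; apply: near0_bigOZ.
    by apply: (@near0_bigOX R 1 2); exact: near0_bigO_id.
  apply: (@near0_bigO_le R _ (2 * (d - j) + j.+1)); first by lia.
  apply: near0_bigOM h1 _; apply: near0_bigOD.
    apply: near0_bigOMb => //; apply: near0_bigO_le (hx _); lia.
  apply: near0_bigOZ; apply: near0_bigO_le (hy _); lia.
apply: (near0_bigO_ext e0 _ (near0_bigO_sum (index_enum 'I_d.+1) term)) => s hs.
have [_ _ cc] := hcc s hs.
rewrite /scaled_moment mulr_sumr -sumrB cc; apply: eq_bigr => j _.
by rewrite /x /y; ring.
Qed.

Variable Rp : {poly R}.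
Hypothesis HRp : is_finite_R_transform m d p Rp.

Lemma finite_R_transform0 : Rp`_0 = 0.
Proof.
have [_ /(_ 0%N (leq0n _))] := HRp.
rewrite coefD coefZ coef0M coefXM /= addr0 Ep_0 // mulr1 => /eqP.
by rewrite mulf_eq0 pnatr_eq0 -leqn0 leqNgt d_gt0 => /eqP.
Qed.

(** The terms in [al] cancel, and what is left is a multiple of d R E + u E' at u = s^2, the
    polynomial in the defining congruence of R. *)
Lemma finite_R_transform_log_deriv (al : R) :
  near0_bigO d.+1 (fun s : R => (m`! * d`!)%:R * (al *: E - 'X * E^`()).[s ^+ 2]
     - (al + d%:R * Rp.[s ^+ 2]) * ((m`! * d`!)%:R * E.[s ^+ 2])).
Proof.
have dv : 'X^(d.+1) %| d%:R *: (Rp * E) + 'X * E^`().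
  by apply: coef_dvdXn => i; rewrite ltnS => /(HRp.2).
have h2 : near0_bigO 1 (fun s : R => s ^+ 2).
  by apply: (@near0_bigO_le R 1 2) => //; apply: (@near0_bigOX R 1 2); exact: near0_bigO_id.
apply: (near0_bigO_ext ltr01 _ (near0_bigOZ (- (m`! * d`!)%:R) (near0_bigO_dvdX h2 dv))) => s _.
rewrite !(hornerD, hornerN, hornerZ, hornerM, hornerX); ring.
Qed.

Lemma Rtilde_asymp : exists F (e : R), [/\ analytic0 F, 0 < e,
  forall s, 0 < s < e -> Rtilde m d p s = F s &
  near0_bigO d.+1 (fun s => F s - (Rp \Po 'X^2).[s])].
Proof.
have dR0 : 0 < d%:R :> R by rewrite ltr0n.
have mR0 : 0 < m%:R :> R by rewrite ltr0n (leq_trans d_gt0).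
have N0 : 0 < N by exact: smd_gt0.
have N2 : N ^+ 2 = m%:R * d%:R by exact: smd_sqr.
have [rho [tau [e1 [arho atau e10 hrt]]]] := rf_tf_analytic rs_ge0 d_gt0 d_le_m size_rs.
pose c s := N * (s * rho s); pose c' s := N * (s * tau s).
have ac : analytic0 c by apply: analytic0Z; apply: analytic0M => //; exact: analytic0_id.
have ac' : analytic0 c' by apply: analytic0Z; apply: analytic0M => //; exact: analytic0_id.
have oc : near0_bigO 1 c.
  by apply: near0_bigOZ; apply: near0_bigOMb; [exact: near0_bigO_id | exact: analytic0_bigO0].
have oc' : near0_bigO 1 c'.
  by apply: near0_bigOZ; apply: near0_bigOMb; [exact: near0_bigO_id | exact: analytic0_bigO0].
have hcc s : 0 < s < e1 -> [/\ 0 < c s, 0 < c' s & c s * c' s = m%:R * d%:R * s ^+ 2].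
  move=> /hrt[Er Et r0 t0 rt]; rewrite /c /c' -Er -Et; split; try exact: mulr_gt0.
  by rewrite -N2 -rt; ring.
pose T i k s := scaled_moment rs m d i k (c s) (c' s).
pose w s := expR (- (c s * a)) * expR (- (c' s * a)).
have w0 s : 0 < w s by rewrite mulr_gt0 ?expR_gt0.
have aT i k : analytic0 (T i k).
  apply: analytic0_sum => j; apply: analytic0M.
    by apply: analytic0Z; apply: analytic0X; exact: analytic0M.
  by apply: analytic0M; apply: analytic0_comp_horner; apply: analytic0M => //; exact: analytic0_cst.
have as2 : near0_bigO 1 (fun s : R => s ^+ 2).
  by apply: (@near0_bigO_le R 1 2) => //; apply: (@near0_bigOX R 1 2); exact: near0_bigO_id.
pose M : R := (m`! * d`!)%:R.
have M0 : 0 < M by rewrite ltr0n muln_gt0 !fact_gt0.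
have as00 : near0_bigO d.+1 (fun s => w s * T 0 0 s - M * E.[s ^+ 2]).
  have := scaled_moment_asymp 0 0 e10 oc oc' hcc; apply: (near0_bigO_ext ltr01) => s _.
  by rewrite horner_Ep_00.
have as10 : near0_bigO d.+1 (fun s => w s * T 1 0 s - M * (d.+1%:R *: E - 'X * E^`()).[s ^+ 2]).
  have := scaled_moment_asymp 1 0 e10 oc oc' hcc; apply: (near0_bigO_ext ltr01) => s _.
  by rewrite horner_Ep_10.
have as01 : near0_bigO d.+1 (fun s => w s * T 0 1 s - M * (m.+1%:R *: E - 'X * E^`()).[s ^+ 2]).
  have := scaled_moment_asymp 0 1 e10 oc oc' hcc; apply: (near0_bigO_ext ltr01) => s _.
  by rewrite horner_Ep_01.
(* The limit at 0 is [M] times E(0) = 1. *)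
have [|e2 e20 hden] := @near0_bigO_pos _ (fun s => w s * T 0 0 s) M M0.
  have h1 := near0_bigOZ M (near0_bigO_horner_sub0 E as2).
  apply: (near0_bigO_ext ltr01 _ (near0_bigOD (near0_bigO_le (ltn0Sn d) as00) h1)) => s _.
  by rewrite Ep_0 //; ring.
pose e3 := Num.min e1 e2.
have e30 : 0 < e3 by rewrite lt_min e10.
have M20 : 0 < M / 2 by rewrite divr_gt0.
have hT s : 0 < s < e3 -> M / 2 <= T 0 0 s.
  rewrite lt_min => /and3P[s0 se1 se2].
  have /hden hd : 0 < s < e2 by rewrite s0.
  have /hcc [c0 c'0 _] : 0 < s < e1 by rewrite s0.
  have T0 : 0 < T 0 0 s by rewrite -(pmulr_rgt0 _ (w0 s)); lra.
  (* The lower bound is known for [w s * T 0 0 s]; w <= 1 passes it to the analytic factor [T 0 0],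
     which has to be inverted. *)
  have w1 : w s <= 1.
    rewrite -[1]mulr1; apply: ler_pM; rewrite ?expR_ge0 // -expR0 ler_expR oppr_le0;
      by rewrite mulr_ge0 ?sqrtr_ge0 // ltW.
  apply: le_trans hd _; by rewrite ler_piMl // ltW.
have T00 : T 0 0 0 != 0.
  by rewrite gt_eqF // (lt_le_trans M20) // (analytic0_ge (aT _ _) e30 hT).
pose A s := T 1 0 s / T 0 0 s; pose B s := T 0 1 s / T 0 0 s.
have aA : analytic0 A by apply: analytic0M => //; exact: analytic0V.
have aB : analytic0 B by apply: analytic0M => //; exact: analytic0V.
pose qA s := d.+1%:R + d%:R * Rp.[s ^+ 2].
pose qB s := m.+1%:R + d%:R * Rp.[s ^+ 2].
have oq (al : R) : near0_bigO 0 (fun s => al + d%:R * Rp.[s ^+ 2]).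
  apply: near0_bigOD; first exact: near0_bigO_cst.
  by apply: near0_bigOZ; apply: near0_bigO_horner; exact: near0_bigO_le as2.
have wT i k s : 0 < s < e3 -> (w s * T i k s) / (w s * T 0 0 s) = T i k s / T 0 0 s.
  move=> /hT h; have T0 : T 0 0 s != 0 by rewrite gt_eqF // (lt_le_trans M20).
  by field; rewrite T0 gt_eqF.
have hA : near0_bigO d.+1 (fun s => A s - qA s).
  have := near0_bigO_div M20 e20 hden (oq d.+1%:R) as10 as00 (finite_R_transform_log_deriv _).
  by apply: (near0_bigO_ext e30) => s hs; rewrite wT.
have hB : near0_bigO d.+1 (fun s => B s - qB s).
  have := near0_bigO_div M20 e20 hden (oq m.+1%:R) as01 as00 (finite_R_transform_log_deriv _).
  by apply: (near0_bigO_ext e30) => s hs; rewrite wT.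
pose l := lam R m d.
have l0 : 0 < l by exact: lam_gt0.
have lE : l = d%:R / m%:R by [].
(* The expression under the root: d^(-2) is 1/(lambda md), with md s^2 = c c' shared between [A] and
   [B]. *)
pose F s := d%:R ^- 2 * (A s * B s) + (1 - l) ^+ 2 / (4 * l ^+ 2).
pose kap := (l + 1) / (2 * l) + d%:R^-1.
have kap0 : 0 < kap.
  by apply: addr_gt0; [apply: divr_gt0; [exact: addr_gt0 | exact: mulr_gt0] | rewrite invr_gt0].
pose G s := Rp.[s ^+ 2] + kap.
have aF : analytic0 F.
  by apply: analytic0D; [apply: analytic0Z; exact: analytic0M | exact: analytic0_cst].
(* Replacing A, B by qA, qB in F gives exactly G^2: the factors R + 1 + 1/d and R + 1/lambda + 1/d
   have mean [G] and half-difference (1 - lambda)/(2 lambda). The error is that of AB - qA qB = (A -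
   qA) B + (B - qB) qA. *)
have FG : near0_bigO d.+1 (fun s => F s - G s ^+ 2).
  have h := near0_bigOD (near0_bigOMb hA (analytic0_bigO0 aB)) (near0_bigOMb hB (oq d.+1%:R)).
  apply: (near0_bigO_ext ltr01 _ (near0_bigOZ (d%:R ^- 2) h)) => s _.
  rewrite /F /G /kap /qA /qB lE -!natr1; field.
  by rewrite !gt_eqF.
have hG : near0_bigO 1 (fun s => G s - kap).
  have := near0_bigO_horner_sub0 Rp as2; apply: (near0_bigO_ext ltr01) => s _.
  by rewrite finite_R_transform0 /G; ring.
have [e4 e40 hG0] := near0_bigO_pos kap0 hG.
have kap2 : 0 < kap ^+ 2 by rewrite exprn_gt0.
have [|e5 e50 hF0] := @near0_bigO_pos _ F (kap ^+ 2) kap2.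
  have b : near0_bigO 0 (fun s => G s + kap).
    apply: (near0_bigO_ext ltr01 _ (near0_bigOD (near0_bigO_le (leq0n 1) hG)
      (near0_bigO_cst (kap + kap)))) => s _; ring.
  apply: (near0_bigO_ext ltr01 _ (near0_bigOD (near0_bigO_le (ltn0Sn d) FG) (near0_bigOMb hG b))).
  by move=> s _; ring.
have F0 : 0 < F 0.
  apply: lt_le_trans (analytic0_ge aF e50 hF0); by rewrite divr_gt0.
exists (fun s => Num.sqrt (F s) - kap), e3; split=> //.
- apply: analytic0D; first exact: analytic0_sqrt.
  exact: analytic0_cst.
- move=> s hs; rewrite /Rtilde -/l -/kap; congr (Num.sqrt _ - _).
  have hTs := hT s hs.
  have T0 : 0 < T 0 0 s by apply: lt_le_trans hTs.
  move: hs; rewrite lt_min => /and3P[s0 se1 _].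
  have hs1 : 0 < s < e1 by rewrite s0.
  have [Er Et r0 t0 rt] := hrt s hs1; have [c0 c'0 cc] := hcc s hs1.
  have Ec : N * rf m d p s = c s by rewrite Er.
  have Ec' : N * tf m d p s = c' s by rewrite Et.
  pose I i k := tilted_moment rs m d i k (c s) (c' s).
  have sc i k : c s ^+ (d.+1 + i) * c' s ^+ (m.+1 + k) * I i k = w s * T i k s.
    by apply: tilted_moment_scaled; rewrite ?gt_eqF.
  have I0 : 0 < I 0 0.
    have cg0 : 0 < c s ^+ (d.+1 + 0) * c' s ^+ (m.+1 + 0).
      by apply: mulr_gt0; exact: exprn_gt0.
    by have := mulr_gt0 (w0 s) T0; rewrite -sc pmulr_rgt0.
  have EQ : Qf m d p s = (I 1 0 / I 0 0) * (I 0 1 / I 0 0).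
    have I0' : 0 < tilted_moment rs m d 0 0 (N * rf m d p s) (N * tf m d p s).
      by rewrite Ec Ec'.
    have E1 := derive1_ln_normq_l rs_ge0 d_gt0 d_le_m size_rs r0 t0 I0'.
    have E2 := derive1_ln_normq_r rs_ge0 d_gt0 d_le_m size_rs r0 t0 I0'.
    by rewrite -mulrNN /I -Ec -Ec'; exact: f_equal2 E1 E2.
  have cn0 : c s != 0 by rewrite gt_eqF.
  have c'n0 : c' s != 0 by rewrite gt_eqF.
  have In0 : I 0 0 != 0 by rewrite gt_eqF.
  have Tn0 : T 0 0 s != 0 by rewrite gt_eqF.
  have wn0 : w s != 0 by rewrite gt_eqF.
  (* The scaling exponent for i = 1 has exactly one more c than for i = 0; the exponentials
     cancel. *)
  have EA : A s = c s * (I 1 0 / I 0 0).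
    transitivity ((w s * T 1 0 s) / (w s * T 0 0 s)); first by rewrite /A; field; rewrite Tn0.
    rewrite -!sc !addn0 addn1 exprS; field.
    by rewrite In0 !expf_neq0.
  have EB : B s = c' s * (I 0 1 / I 0 0).
    transitivity ((w s * T 0 1 s) / (w s * T 0 0 s)); first by rewrite /B; field; rewrite Tn0.
    rewrite -!sc !addn0 addn1 [c' s ^+ m.+2]exprS; field.
    by rewrite In0 !expf_neq0.
  rewrite /F EA EB EQ; congr (_ + _).
  transitivity (d%:R ^- 2 * ((c s * c' s) * ((I 1 0 / I 0 0) * (I 0 1 / I 0 0)))); last by ring.
  rewrite cc lE; move: (_ * (I 0 1 / _)) => z; field.
  by rewrite !gt_eqF.
- have e60 : 0 < Num.min e4 e5 by rewrite lt_min e40.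
  have k2 : 0 < kap / 2 by rewrite divr_gt0.
  have h := @near0_bigO_sqrt _ d.+1 F G (kap / 2) (Num.min e4 e5) k2 e60.
  apply: (near0_bigO_ext ltr01 _ (h _ _ FG)) => s; rewrite ?lt_min.
  + by move=> _; rewrite /G horner_comp hornerXn; ring.
  + by move=> /and3P[s0 se _]; apply: hG0; rewrite s0.
  + move=> /and3P[s0 _ se]; apply: le_trans (hF0 s _); last by rewrite s0.
    by rewrite ltW // divr_gt0.
Qed.

End Asymptotics.

Unset Implicit Arguments.

Theorem mainTheorem6 (R : realType) (m d : nat) (p : {poly R})
  (Rp : {poly R}) :
  (1 <= d)%N -> (d <= m)%N ->
  p \is monic -> size p = d.+1 ->
  (exists rs : seq R, all (fun x => 0 <= x) rs /\
     p = \prod_(x <- rs) ('X - x%:P)) ->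
  is_finite_R_transform m d p Rp ->
  exists a : nat -> R, exists eps : R, 0 < eps /\
    (forall s : R, 0 < s < eps ->
       series (fun k => a k * s ^+ k) @ \oo --> Rtilde m d p s) /\
    (forall k : nat, (k <= d)%N -> a k = (Rp \Po 'X^2)`_k).
Proof.
move=> d_gt0 d_le_m _ size_p [rs [rs_ge0 pE]] HRp.
move: size_p HRp; rewrite pE size_prod_XsubC => -[size_rs] HRp.
have [F [e [aF e0 FE FO]]] := Rtilde_asymp rs_ge0 d_gt0 d_le_m size_rs HRp.
have [a [e' [e'0 ha ca]]] := analytic0_power_series aF.
exists a, (Num.min e e'); rewrite lt_min e0 e'0; split=> //; split.
  by move=> s; rewrite lt_min => /and3P[s0 se se']; rewrite FE ?s0 //; apply: ha; rewrite s0.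
by move=> k kd; exact: ca FO _ _.
Qed.
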